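(* Let $p$ be a prime and $q$ a power of $p$. Let $k$ be an algebraically closed field of characteristic $p$ and $V=k^n$ with $n>2$. Suppose that $G<\mathrm{GL}(V)$ is a finite group that contains a normal subgroup $S\cong\mathrm{SL}_n(q)$. Then $(G,V)$ is adequate.
   Context: Let $k$ be a field of characteristic $p$, $V$ a finite-dimensional $k$-vector space and $\rho:G\to\mathrm{GL}(V)$ an absolutely irreducible representation. $(G,V)$ is called adequate if: (1) $H^1(G,k)=0$; (2) $H^1(G,(V^*\otimes V)/k)=0$, where $k\subset V^*\otimes V\cong\mathrm{End}(V)$ is the subspace of scalars; (3) $\mathrm{End}(V)$ is spanned over $k$ by the elements $\rho(g)$, $g\in G$, with $\rho(g)$ semisimple. (Absolute irreducibility of $V$ is part of being adequate; $p$ may divide $\dim V$.) *)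

(* Defs.v *)
From mathcomp Require Import all_boot all_order all_algebra.
From mathcomp Require Import all_fingroup all_solvable all_field all_character.

Set Implicit Arguments.
Unset Strict Implicit.
Unset Printing Implicit Defensive.

Import GroupScope GRing.Theory.
Local Open Scope ring_scope.

(* As in mathcomp, {'GL_n[F]} consists of matrices of size n.-1.+1, so SL 0 F
   is a copy of SL 1 F. *)
Section SpecialLinearGroup.

Variables (n : nat) (F : finFieldType).

Definition SL : {set {'GL_n[F]}} := [set u | \det (GLval u) == 1].

Lemma SL_group_set : group_set SL.
Proof.
apply/group_setP; split=> [|u v]; first by rewrite inE /= det1.
by rewrite !inE /= det_mulmx => /eqP-> /eqP->; rewrite mulr1.
Qed.

Canonical SL_group := Group SL_group_set.

End SpecialLinearGroup.

(* A representation rG of G makes the space of row vectors a right module, with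
   v.x = v *m rG x; hence the right-handed cocycle condition
   f (x * y) = (f x).y + f y. *)
Section FirstCohomology.

Variables (k : fieldType) (gT : finGroupType) (G : {group gT}) (m : nat).
Variable rG : mx_representation k G m.

Definition cocycle1 (f : gT -> 'rV[k]_m) : Prop :=
  {in G &, forall x y, f (x * y)%g = f x *m rG y + f y}.

Definition coboundary1 (f : gT -> 'rV[k]_m) : Prop :=
  exists v : 'rV[k]_m, {in G, forall x, f x = v *m rG x - v}.

Definition H1_eq0 : Prop := forall f, cocycle1 f -> coboundary1 f.

End FirstCohomology.

Section Modules.

Variables (k : fieldType) (gT : finGroupType) (G : {group gT}).

Lemma triv_mx_repr : mx_repr G (fun _ : gT => 1%:M : 'M[k]_1).
Proof. by split=> // x y _ _; rewrite mul1mx. Qed.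

Definition triv_repr : mx_representation k G 1 := MxRepresentation triv_mx_repr.

Variables (n : nat) (rG : mx_representation k G n).

(* End(V), encoded by mxvec, with the right action A.x = (rG x)^-1 A (rG x). *)
Definition End_mx (x : gT) : 'M[k]_(n * n) :=
  lin_mx (mulmxr (rG x) \o mulmx (rG x^-1%g)).

Lemma mul_End_mx (A : 'M[k]_n) x :
  mxvec A *m End_mx x = mxvec (rG x^-1%g *m A *m rG x).
Proof. by rewrite mul_vec_lin. Qed.

Lemma End_mx_repr : mx_repr G End_mx.
Proof.
split=> [|x y Gx Gy]; apply/row_matrixP=> i; rewrite !rowE.
  rewrite -[delta_mx _ _]vec_mxK mul_End_mx invg1 repr_mx1 mul1mx !mulmx1.
  by [].
rewrite mulmxA -[delta_mx _ _]vec_mxK !mul_End_mx invMg.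
by rewrite !repr_mxM ?groupV // !mulmxA.
Qed.

Definition End_repr : mx_representation k G (n * n) :=
  MxRepresentation End_mx_repr.

(* The subspace of scalars of End(V). *)
Definition scalars_mx : 'M[k]_(n * n) := <<mxvec (1%:M : 'M[k]_n)>>%MS.

Lemma scalars_mxmodule : mxmodule End_repr scalars_mx.
Proof.
apply/mxmoduleP=> x Gx; rewrite (eqmxMr _ (genmxE _)) genmxE.
by rewrite mul_End_mx mulmx1 -repr_mxM ?groupV // mulVg repr_mx1.
Qed.

Definition End_mod_scalars_repr :
    mx_representation k G (\rank (cokermx scalars_mx)) :=
  factmod_repr scalars_mxmodule.

End Modules.

Definition semisimple_mx (k : fieldType) (n : nat) (A : 'M[k]_n) : Prop :=
  forall U : 'M[k]_n, stablemx U A ->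
  exists W : 'M[k]_n,
    [/\ stablemx W A, (U + W :=: 1%:M)%MS & (U :&: W)%MS = 0].

Definition spanned_by_semisimple (k : fieldType) (gT : finGroupType)
    (G : {group gT}) (n : nat) (rG : mx_representation k G n) : Prop :=
  forall A : 'M[k]_n, exists2 c : gT -> k,
    {in G, forall x, c x != 0 -> semisimple_mx (rG x)} &
    A = \sum_(x in G) c x *: rG x.

Definition adequate (k : fieldType) (gT : finGroupType) (G : {group gT})
    (n : nat) (rG : mx_representation k G n) : Prop :=
  [/\ mx_absolutely_irreducible rG,
      H1_eq0 (triv_repr k G),
      H1_eq0 (End_mod_scalars_repr rG)
    & spanned_by_semisimple rG].

(* Main.v *)
Require Import Defs.
From HB Require Import structures.
From mathcomp Require Import all_boot all_order all_algebra.
From mathcomp Require Import all_fingroup all_solvable all_field all_character.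
From mathcomp Require Import ring zify.

Set Implicit Arguments.
Unset Strict Implicit.
Unset Printing Implicit Defensive.

Import GroupScope GRing.Theory.
Local Open Scope ring_scope.

(** Write x_ij(a) = 1 + a E_ij for the root elements of SL_n(F), where F is the
    field with q elements. They generate SL_n(F), x_ij and
    x_lm commute when j differs from l and i from m, and they satisfy
    [x_ij(a), x_jl(b)] = x_il(ab). Since n > 2 there is always a third index
    available, and each of the conditions of adequacy follows from these
    relations by linear algebra.

    The module. It has to be shown that V restricted to S is the natural module
    or its dual, up to an embedding s of F into k ([root_classification]).
    Only the relations are used. The group L_m generated by the x_ij with
    i, j < m cannot act nontrivially in degree less than m: the row
    U = { x_mj : j < m } is a p-group normalised by L_m, so its fixed space C is
    a proper nonzero submodule, and L_m acts nontrivially on C or on V/C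
    ([root_group_lower_bound]). In the extremal degree n the same argument
    forces C or V/C to be a line, so every x_ij(a) - 1 has rank one, either with
    the same column for all j or with the same row for all j
    ([lower_bound_step]). Comparing with the transposed system
    x_ji(-a), the alternative is the same for all i ([uniform_type]), and after a
    change of basis x_ij(a) = 1 + s(a) E_ij ([elementary_form]).

    H^1(G, End(V)/k) = 0. A cocycle f is replaced by D(g) = r(g) f(g), which
    satisfies the Leibniz rule up to multiples of r(gh), while coboundaries
    become commutators X r(g) - r(g) X. The relations among the x_zi(1), for a
    fixed z, make D inner on that row ([row_inner]). Two rows can be treated
    with one X ([null_two_rows]), and two rows and the commutator relations
    determine D on all x_ij(1) ([null_prime_roots]). What is left on the x_ij(a)
    is a derivation of the finite field F, which vanishes as a = a^q and q = 0
    in k ([null_all_roots]). So D is inner on S, and then on G, as S is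
    normal and only scalars commute with S modulo scalars ([proj_der_inner]).

    H^1(G, k) = 0. A homomorphism f from G to k kills S, because S is generated
    by commutators, and kills the scalars in G, whose orders are prime to p. An
    element g of G normalises S, hence the F-span M_n(F) of S, so it is a scalar
    multiple of a matrix over F. Therefore g^(q-1) is a scalar times an element
    of S and f(g) = - f(g^(q-1)) = 0 ([H1_trivial]).

    Spanning. Elements of order prime to p are semisimple by Maschke's theorem,
    and their span is stable under conjugation by root elements. It contains
    enough of one element of order 2 (p odd) or 3 (p = 2) to contain
    all E_ij ([p'span_all]). Absolute irreducibility follows from the
    spanning. *)

(** * Elementary matrices and transvections *)

Definition transv (k : pzRingType) n (i j : 'I_n) (a : k) : 'M[k]_n :=
  1%:M + a *: delta_mx i j.

Lemma mul_mx_delta (k : pzRingType) n (A : 'M[k]_n) (l m r s : 'I_n) :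
  (A *m delta_mx l m) r s = A r l * (s == m)%:R.
Proof.
rewrite !mxE (bigD1 l) //= mxE eqxx /= big1 ?addr0 // => i /negbTE il.
by rewrite mxE il /= mulr0.
Qed.

Lemma mul_delta_mxE (k : pzRingType) n (A : 'M[k]_n) (l m r s : 'I_n) :
  (delta_mx l m *m A) r s = (r == l)%:R * A m s.
Proof.
rewrite !mxE (bigD1 m) //= mxE eqxx andbT big1 ?addr0 // => i /negbTE im.
by rewrite mxE im andbF mul0r.
Qed.

Lemma transvE (k : fieldType) n (i j : 'I_n) (a : k) r s :
  transv i j a r s = (r == s)%:R + a * ((r == i) && (s == j))%:R.
Proof. by rewrite !mxE. Qed.

Lemma mul_mx_transv (k : fieldType) n (A : 'M[k]_n) (l m : 'I_n) (a : k) r s :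
  (A *m transv l m a) r s = A r s + A r l * a * (s == m)%:R.
Proof.
rewrite mulmxDr mulmx1 mxE; congr (_ + _).
rewrite !mxE (bigD1 l) //= !mxE eqxx /= big1 ?addr0 ?mulrA // => i /negbTE il.
by rewrite !mxE il /= !mulr0.
Qed.

Lemma mul_transv_mx (k : fieldType) n (A : 'M[k]_n) (l m : 'I_n) (a : k) r s :
  (transv l m a *m A) r s = A r s + (r == l)%:R * a * A m s.
Proof.
rewrite mulmxDl mul1mx mxE -scalemxAl mxE mul_delta_mxE; congr (_ + _).
by case: (r == l); rewrite ?mul1r ?mul0r ?mulr0.
Qed.

Section MatrixEntries.

Variables (k : fieldType) (m n : nat).
Implicit Types A B : 'M[k]_(m, n).

Lemma addmxE A B i j : (A + B) i j = A i j + B i j.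
Proof. by rewrite mxE. Qed.

Lemma oppmxE A i j : (- A) i j = - A i j.
Proof. by rewrite mxE. Qed.

Lemma scalemxE (a : k) A i j : (a *: A) i j = a * A i j.
Proof. by rewrite mxE. Qed.

Definition mx_linE := (addmxE, oppmxE, scalemxE).

End MatrixEntries.

Lemma ex_third n (i j : 'I_n) : (2 < n)%N -> exists l : 'I_n, (l != i) && (l != j).
Proof.
move=> n3; case: (pickP (fun l : 'I_n => (l != i) && (l != j))) => [l|no]; first by exists l.
have sub : {subset 'I_n <= [:: i; j]}.
  by move=> l _; move: (no l); rewrite !inE; case: eqP; case: eqP.
have := max_card (mem [:: i; j]).
have := subset_leq_card (introT subsetP sub); rewrite card_ord => h _.
by have := leq_trans h (card_size [:: i; j]); rewrite /= leqNgt n3.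
Qed.

(** * Derivations modulo scalars *)

Section ProjectiveDerivations.

Variables (k : fieldType) (gT : finGroupType) (H : {group gT}) (n : nat).
Variable r : gT -> 'M[k]_n.
Hypothesis rM : {in H &, forall g h, r (g * h)%g = r g *m r h}.

(** A 1-cocycle f with values in End(V)/k, for the action f.g = r(g)^-1 f r(g),
    corresponds to D(g) = r(g) f(g), and the coboundary of X to the commutator
    X r(g) - r(g) X. In this form no inverse occurs, so at root elements every
    relation gives equations that are linear in the entries of D. *)
Definition proj_der (D : gT -> 'M[k]_n) : Prop :=
  {in H &, forall g h, exists l : k,
     D (g * h)%g = D g *m r h + r g *m D h + l *: r (g * h)%g}.

Lemma proj_derB D X : proj_der D ->
  proj_der (fun g => D g - (X *m r g - r g *m X)).
Proof.
move=> dD g h Hg Hh; have [l ->] := dD g h Hg Hh; exists l.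
rewrite /= rM //.
rewrite !mulmxBr !mulmxBl ?mulmxA.
by apply/matrixP=> u v; rewrite !mx_linE; ring.
Qed.

Lemma proj_derZ D (c : gT -> k) : proj_der D ->
  proj_der (fun g => D g + c g *: r g).
Proof.
move=> dD g h Hg Hh; have [l ->] := dD g h Hg Hh.
exists (l + c (g * h)%g - c g - c h).
rewrite /= mulmxDl mulmxDr -scalemxAl -scalemxAr -rM //.
by apply/matrixP=> u v; rewrite !mx_linE; ring.
Qed.

(** Comparing D(gh) with D(hg): the equations are those of
    [D(g), b E_lm] - [D(h), a E_ij] = c r(gh), read entrywise. *)
Lemma comm_entry D g h i j a l m b : proj_der D -> g \in H -> h \in H ->
    r g = transv i j a -> r h = transv l m b -> commute g h -> j != l ->
  exists c : k, forall u v,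
  b * (D g u l * (v == m)%:R - (u == l)%:R * D g m v)
  - a * (D h u i * (v == j)%:R - (u == i)%:R * D h j v)
  = c * ((u == v)%:R + a * ((u == i) && (v == j))%:R
                     + b * ((u == l) && (v == m))%:R).
Proof.
move=> dD Hg Hh rg rh cgh jl.
have [c1 e1] := dD g h Hg Hh; have [c2 e2] := dD h g Hh Hg.
exists (c2 - c1) => u v; move/matrixP/(_ u v): e1; move/matrixP/(_ u v): e2.
rewrite -cgh => -> /esym; rewrite !rM //.
rewrite rg rh !mx_linE !mul_mx_transv !mul_transv_mx !transvE.
rewrite (eq_sym l j) (negbTE jl) !andbF !mulr0 !addr0 -!mulnb !natrM /=.
move/eqP; rewrite -subr_eq0 => /eqP e.
apply/eqP; rewrite -subr_eq0 -[X in _ == X]e; apply/eqP.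
by case: (v == m); case: (u == l); case: (u == i); case: (v == j); case: (u == v) => /=; ring.
Qed.

(** Comparing D(gh) with D(hgt), for the relation x_ij x_jl = x_jl x_ij x_il. *)
Lemma commutator_entry D g h t i j a l b : proj_der D ->
    g \in H -> h \in H -> t \in H ->
    r g = transv i j a -> r h = transv j l b -> r t = transv i l (a * b) ->
    (g * h = h * g * t)%g -> i != j -> j != l -> i != l ->
  exists c : k, forall u v,
    b * D g u j * (v == l)%:R + a * (u == i)%:R * D h j v
  = a * D h u i * (v == j)%:R + a * b * D h u i * (v == l)%:R
    + b * (u == j)%:R * D g l v + a * b * D g u i * (v == l)%:R
    + a * b * b * (u == j)%:R * (v == l)%:R * D g l i
    + D t u v + a * (u == i)%:R * D t j v + b * (u == j)%:R * D t l v
    + c * ((u == v)%:R + a * ((u == i) && (v == j))%:R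
           + b * ((u == j) && (v == l))%:R + a * b * ((u == i) && (v == l))%:R).
Proof.
move=> dD Hg Hh Ht rg rh rt ght ij jl il.
have [c1 e1] := dD g h Hg Hh; have [c2 e2] := dD h g Hh Hg.
have [c3 e3] := dD (h * g)%g t (groupM Hh Hg) Ht.
exists (c2 + c3 - c1) => u v.
move: e1; rewrite -ght in e3; rewrite e3 e2 !mulmxDl -scalemxAl.
rewrite -[r (h * g)%g *m r t]rM ?groupM // -ght !(rM Hg, rM Hh Hg) //.
rewrite -(mulmxA (r h) (r g)) => /matrixP/(_ u v).
rewrite rg rh rt !mx_linE !(mul_mx_transv, mul_transv_mx) !transvE.
rewrite ?(eq_sym j i) ?(eq_sym l i) ?(eq_sym l j).
rewrite ?(negbTE ij) ?(negbTE il) ?(negbTE jl) ?andbF eqxx ?andbT.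
move/eqP; rewrite -subr_eq0 => /eqP e.
apply/eqP; rewrite -subr_eq0 -oppr_eq0; apply/eqP; apply: etrans e.
rewrite -!mulnb !natrM.
by case: (v == l); case: (u == j); case: (u == i); case: (v == j); case: (u == v) => /=; ring.
Qed.

End ProjectiveDerivations.

(** * Linear identities between matrix entries *)

(** The equations obtained for entries are combined linearly: the tactics [lc]
    and [lc2] take the coefficients of the combination, so that only a ring
    identity remains to be checked. *)
Lemma lincomb1 (R : comPzRingType) (c x y : R) (a b : R) :
  x = y -> a - b = c * (x - y) -> a = b.
Proof. by move=> ->; rewrite subrr mulr0 => /eqP; rewrite subr_eq0 => /eqP. Qed.

Lemma lincomb2 (R : comPzRingType) (c x y d z t : R) (a b : R) :
  x = y -> z = t -> a - b = c * (x - y) + d * (z - t) -> a = b.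
Proof.
move=> -> /(lincomb1 (c := d)) h ?; apply: h.
by rewrite -[RHS]add0r -(mulr0 c) -[X in c * X](subrr y).
Qed.

Ltac lc e c := apply: (lincomb1 (c := c) e); ring.
Ltac lc2 e c f d := apply: (lincomb2 (c := c) (d := d) e f); ring.

(** An entry of a product with an elementary matrix is a sum of terms weighted
    by index comparisons; those that the context decides are evaluated here. *)
Ltac simp_eq :=
  rewrite ?eqxx;
  repeat match goal with
  | H : is_true (?a != ?b) |- context [?a == ?b] => rewrite (negbTE H)
  | H : is_true (?a != ?b) |- context [?b == ?a] => rewrite (eq_sym b a) (negbTE H)
  end;
  rewrite ?andbF ?andbT /= ?mulr1n ?mulr0n
    ?(mulr0, mul0r, mulr1, mul1r, addr0, add0r, oppr0, subr0, sub0r).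

(** * Relations between transvections, and generation *)

Lemma transv_comm (k : fieldType) n (i j l m : 'I_n) (a b : k) :
  j != l -> i != m ->
  transv i j a *m transv l m b = transv l m b *m transv i j a.
Proof.
move=> jl im; apply/matrixP=> u v; rewrite !mul_mx_transv !transvE; simp_eq.
by case: (u == v); case: (u == i); case: (v == j); case: (u == l); case: (v == m) => /=; ring.
Qed.

Lemma transv_commutator (k : fieldType) n (i j l : 'I_n) (a b : k) :
  i != j -> j != l -> i != l ->
  transv i j a *m transv j l b
  = transv j l b *m transv i j a *m transv i l (a * b).
Proof.
move=> ij jl il; apply/matrixP=> u v; rewrite !mul_mx_transv !transvE; simp_eq.
by case: (u == v); case: (u == i); case: (v == j); case: (u == j); case: (v == l) => /=; ring.
Qed.

Section TransvectionsGenerate.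

Variables (F : fieldType).

Lemma transvK n (i j : 'I_n) (a : F) : i != j ->
  transv i j (- a) *m transv i j a = 1%:M.
Proof.
move=> ij; apply/matrixP=> u v; rewrite mul_mx_transv !transvE mxE; simp_eq.
by case: (u == v); case: (u == i); case: (v == j) => /=; ring.
Qed.

Lemma transvVK n (i j : 'I_n) (a : F) : i != j ->
  transv i j a *m transv i j (- a) = 1%:M.
Proof. by move=> ij; rewrite -{1}(opprK a) transvK. Qed.

Lemma det_transv n (i j : 'I_n) (a : F) : i != j -> \det (transv i j a) = 1.
Proof.
wlog ltij : n i j / (i < j)%N => [hw ij|ij].
  have := ij; rewrite neq_ltn => /orP[ltij|ltji]; first by apply: hw.
  by rewrite -det_tr linearD linearZ /= trmx1 trmx_delta; apply: hw; rewrite // eq_sym.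
rewrite -det_tr det_trig.
  apply: big1 => u _; rewrite mxE transvE eqxx.
  by case: eqP => [->|_]; rewrite /= ?(negbTE ij) mulr0 addr0.
apply/is_trig_mxP=> u v uv; rewrite mxE transvE.
have -> : (v == u) = false by rewrite -val_eqE gtn_eqF.
rewrite add0r; case: eqP => [eu|_] /=; last by rewrite mulr0.
case: eqP => [ev|_] /=; last by rewrite mulr0.
by rewrite eu ev ltnNge ltnW in uv.
Qed.

(** Generation by transvections is expressed by quantifying over the predicates
    closed under products rather than over words or subgroups: the same
    statement then serves for lifting matrices to an abstract group and for the
    induction on the size. *)
Variant transv_closed n (K : 'M[F]_n -> Prop) : Prop := TransvClosed of
  K 1%:M & (forall A B, K A -> K B -> K (A *m B)) &
  (forall i j a, i != j -> K (transv i j a)).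

Lemma transv_closedl n (K : 'M[F]_n -> Prop) i j a A : transv_closed K ->
  i != j -> K (transv i j a *m A) -> K A.
Proof.
move=> [_ KM Kt] ij KA; rewrite -[A]mul1mx -(transvK a ij) -mulmxA.
by apply: KM => //; apply: Kt.
Qed.

Lemma transv_closedr n (K : 'M[F]_n -> Prop) i j a A : transv_closed K ->
  i != j -> K (A *m transv i j a) -> K A.
Proof.
move=> [_ KM Kt] ij KA; rewrite -[A]mulmx1 -(transvVK a ij) mulmxA.
by apply: KM => //; apply: Kt.
Qed.

(** Gaussian elimination. If the entry (z, z) is 1, transvections clear the rest
    of column z and of row z, and the induction hypothesis applies to the
    predicate that holds for D when K holds for the block matrix 1 + D. A nonzero
    entry below the corner is used to make that entry 1; if there is none, the
    corner itself is nonzero and one transvection creates one. *)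
Lemma det1_transv_closed n (K : 'M[F]_n -> Prop) : transv_closed K ->
  forall A, \det A = 1 -> K A.
Proof.
case: n K => [|n] K Kcl A detA.
  by have [K1 _ _] := Kcl; rewrite (flatmx0 A) -(flatmx0 1%:M).
elim: n K Kcl A detA => [|n' IHn] K Kcl A detA.
  have [K1 _ _] := Kcl; suff -> : A = 1%:M by [].
  by apply/matrixP=> i j; rewrite !ord1 -det_mx11 detA mxE.
set n := n'.+1 in IHn K Kcl A detA *; rewrite -[n.+1]/(1 + n)%N in K Kcl A detA *.
pose z : 'I_(1 + n) := ord0.
(* a matrix that is already of block shape *)
have blockP (B : 'M[F]_(1 + n)) : \det B = 1 -> B z z = 1 ->
    (forall i, i != z -> B i z = 0) -> (forall i, i != z -> B z i = 0) -> K B.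
  move=> detB Bzz Biz Bzi.
  have rz (i : 'I_n) : rshift 1 i != z by [].
  have lz (i : 'I_1) : lshift n i = z by apply: val_inj; rewrite (ord1 i).
  have EB : B = block_mx 1%:M 0 0 (drsubmx B).
    rewrite -[LHS]submxK; congr block_mx; apply/matrixP=> i j; rewrite !mxE.
    - by rewrite !lz Bzz !ord1.
    - by rewrite lz Bzi.
    by rewrite lz Biz.
  have := detB; rewrite EB det_ublock det1 mul1r => detD.
  have [K1 KM Kt] := Kcl.
  apply: (IHn (fun D => K (block_mx 1%:M 0 0 D))) detD; split.
  - by rewrite -scalar_mx_block.
  - move=> C D KC KD; have := KM _ _ KC KD.
    by rewrite mulmx_block !mul1mx !mul0mx !mulmx0 !addr0 !add0r.
  move=> i j a ij; have := Kt (rshift 1 i) (rshift 1 j) a.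
  rewrite (inj_eq (@rshift_inj _ _)) => /(_ ij); congr K.
  rewrite -[LHS]submxK; congr block_mx; apply/matrixP=> u v; rewrite !mxE.
  - by rewrite !lz !ord1 mulr0 addr0.
  - by rewrite lz mulr0 addr0.
  - by rewrite lz andbF mulr0 addr0.
  by rewrite !(inj_eq (@rshift_inj _ _)).
(* column z is clear: clear row z, by induction on its nonzero entries *)
have rowP m : forall B : 'M[F]_(1 + n), (#|[pred i | (i != z) && (B z i != 0%R)]| <= m)%N ->
    \det B = 1 -> B z z = 1 -> (forall i, i != z -> B i z = 0) -> K B.
  elim: m => [|m IHm] B cB detB Bzz Biz.
    apply: blockP => // i iz; apply/eqP; apply: contraTT cB => Bi.
    by rewrite -ltnNge; apply/card_gt0P; exists i; rewrite inE iz.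
  case: (pickP [pred i | (i != z) && (B z i != 0)]) => [i /= /andP[iz Bi]|no].
    have zi : z != i by rewrite eq_sym.
    apply: (transv_closedr (a := - B z i) Kcl zi); apply: IHm.
    - have := cB; rewrite (cardD1 i) inE iz Bi /= -[m.+1]add1n leq_add2l; apply: leq_trans.
      apply: subset_leq_card; apply/subsetP=> j; rewrite !inE mul_mx_transv Bzz.
      have [->|ji] := eqVneq j i; first by rewrite mulr1 mul1r subrr eqxx andbF.
      by rewrite mulr0 addr0.
    - by rewrite det_mulmx det_transv // mulr1.
    - by rewrite mul_mx_transv (negbTE zi) mulr0 addr0.
    by move=> j jz; rewrite mul_mx_transv (negbTE zi) mulr0 addr0 Biz.
  by apply: IHm => //; rewrite eq_card0 // => i; rewrite !inE; apply: no.
have colP m : forall B : 'M[F]_(1 + n), (#|[pred i | (i != z) && (B i z != 0%R)]| <= m)%N ->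
    \det B = 1 -> B z z = 1 -> K B.
  elim: m => [|m IHm] B cB detB Bzz.
    apply: (rowP _ B (leqnn _)) => // i iz; apply/eqP; apply: contraTT cB => Bi.
    by rewrite -ltnNge; apply/card_gt0P; exists i; rewrite inE iz.
  case: (pickP [pred i | (i != z) && (B i z != 0)]) => [i /= /andP[iz Bi]|no].
    have zi : z != i by rewrite eq_sym.
    apply: (transv_closedl (a := - B i z) Kcl iz); apply: IHm.
    - have := cB; rewrite (cardD1 i) inE iz Bi /= -[m.+1]add1n leq_add2l; apply: leq_trans.
      apply: subset_leq_card; apply/subsetP=> j; rewrite !inE mul_transv_mx Bzz.
      have [->|ji] := eqVneq j i; first by rewrite mulr1 mul1r subrr eqxx andbF.
      by rewrite !mul0r addr0.
    - by rewrite det_mulmx det_transv // mul1r.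
    by rewrite mul_transv_mx (negbTE zi) !mul0r addr0.
  by apply: IHm => //; rewrite eq_card0 // => i; rewrite !inE; apply: no.
(* a nonzero entry in column z, off the corner, turns the corner into 1 *)
have pivotP (B : 'M[F]_(1 + n)) i : \det B = 1 -> i != z -> B i z != 0 -> K B.
  move=> detB iz Bi; have zi : z != i by rewrite eq_sym.
  apply: (transv_closedl (a := (1 - B z z) / B i z) Kcl zi).
  apply: (colP _ _ (leqnn _)); first by rewrite det_mulmx det_transv // mul1r.
  by rewrite mul_transv_mx eqxx mul1r divfK // addrC subrK.
case: (pickP [pred i | (i != z) && (A i z != 0)]) => [i /= /andP[iz Ai]|no].
  exact: pivotP Ai.
have {}no j : j != z -> A j z = 0.
  by move=> jz; move: (no j); rewrite /= jz /= => /negbFE/eqP.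
pose i : 'I_(1 + n) := rshift 1 ord0.
have iz : i != z by [].
apply: (transv_closedl (a := 1) Kcl iz); apply: (pivotP _ i) => //.
  by rewrite det_mulmx det_transv // mul1r.
rewrite mul_transv_mx eqxx !mul1r.
rewrite no // add0r.
apply: contra_eq_neq detA => Az.
rewrite (expand_det_col A z) big1 1?eq_sym ?oner_neq0 // => j _.
have [->|jz] := eqVneq j z; first by rewrite Az mul0r.
by rewrite no // mul0r.
Qed.

End TransvectionsGenerate.

(** * Derivations on one row of root elements *)

Section NormalisedRow.

Variables (k : fieldType) (gT : finGroupType) (H : {group gT}).
Variables (n : nat) (r : gT -> 'M[k]_n) (D : gT -> 'M[k]_n).
Hypothesis n_gt2 : (2 < n)%N.
Hypothesis rM : {in H &, forall g h, r (g * h)%g = r g *m r h}.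
Hypothesis rI : {in H &, injective r}.
Variable y : 'I_n -> 'I_n -> gT.
Hypothesis yH : forall i j, i != j -> y i j \in H.
Hypothesis ry : forall i j, i != j -> r (y i j) = transv i j 1.
Hypothesis torus : forall z i, z != i ->
  exists2 h, h \in H & r h = diag_mx (\row_l (-1) ^+ ((l == z) || (l == i))).
Hypothesis dD : proj_der H r D.

Lemma r_one : r 1%g = 1%:M.
Proof.
have [|j /andP[ij _]] := ex_third (Ordinal (ltnW (ltnW n_gt2))) (Ordinal (ltnW (ltnW n_gt2))).
  exact: n_gt2.
have := rM (group1 H) (yH ij); rewrite mul1g ry // => e.
have := congr1 (mulmx^~ (transv j (Ordinal (ltnW (ltnW n_gt2))) (-1))) e.
rewrite -mulmxA; set u := (transv _ _ _ *m transv _ _ _).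
suff -> : u = 1%:M by rewrite mulmx1 => <-.
apply/matrixP=> a b; rewrite mul_mx_transv !transvE mxE.
by simp_eq; case: (a == j); case: (a == b) => /=; case: (b == _) => /=; ring.
Qed.

Lemma y_comm i j l m : i != j -> l != m -> j != l -> i != m ->
  commute (y i j) (y l m).
Proof.
move=> ij lm jl im; apply: rI; rewrite ?groupM ?yH //.
by rewrite !rM ?yH // !ry // transv_comm.
Qed.

Lemma y_commutator i j l : i != j -> j != l -> i != l ->
  (y i j * y j l = y j l * y i j * y i l)%g.
Proof.
move=> ij jl il; apply: rI; rewrite ?groupM ?yH //.
by rewrite !rM ?groupM ?yH // !ry // transv_commutator // mulr1.
Qed.

Lemma yy_entry i j l m : i != j -> l != m -> j != l -> i != m ->
  exists c : k, forall u v,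
    D (y i j) u l * (v == m)%:R - (u == l)%:R * D (y i j) m v
    - (D (y l m) u i * (v == j)%:R - (u == i)%:R * D (y l m) j v)
  = c * ((u == v)%:R + ((u == i) && (v == j))%:R + ((u == l) && (v == m))%:R).
Proof.
move=> ij lm jl im.
have [c e] := comm_entry rM dD (yH ij) (yH lm) (ry ij) (ry lm) (y_comm ij lm jl im) jl.
by exists c => u v; have := e u v; rewrite !mul1r.
Qed.

Variable z : 'I_n.
Local Notation T i j l := (D (y z i) j l).
(** D(x_zi(1)) matters only modulo multiples of r(x_zi(1)), whose entry (z, z) is
    1, so this is a normalisation. *)
Hypothesis Tzz : forall i, i != z -> T i z z = 0.

(** The entry (z, s) of the Leibniz rule for x_zi(1)^2 = 1, a relation that holds
    in characteristic 2. *)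
Lemma char2_square i s : (2%:R : k) = 0 -> i != z -> s != z -> T i i s = 0.
Proof.
move=> two iz sz; have zi : z != i by rewrite eq_sym.
have yy : (y z i * y z i)%g = 1%g.
  apply: rI; rewrite ?groupM ?yH // rM ?yH // ry // r_one.
  apply/matrixP=> u v; rewrite mul_mx_transv !transvE !mxE; simp_eq.
  suff e : (u == z)%:R * (v == i)%:R * 2%:R = 0 :> k.
    by rewrite -mulnb natrM; lc e (1 : k).
  by rewrite two mulr0.
have [c e] := dD (yH zi) (yH zi); have [d] := dD (group1 H) (group1 H).
rewrite mulg1 r_one mulmx1 mul1mx => ed.
move: e; rewrite yy r_one => e.
have {ed}e1 : D 1%g = - d *: 1%:M.
  apply/matrixP=> u v; move/matrixP/(_ u v): ed; rewrite !mx_linE => ed.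
  by lc ed (-1 : k).
move: e; rewrite e1 => /matrixP/(_ z s); rewrite ry //.
rewrite !mx_linE mul_mx_transv mul_transv_mx !mxE (Tzz iz); simp_eq => e.
by lc2 e (-1 : k) two (- T i z s).
Qed.

(** The relation between x_zi and x_zj. Column z of T i has at most the entry at
    j. If there is a fourth index u, the entry (u, u) shows that this one is zero;
    in general the entries (z, z) and (i, i) show that three times it is zero. *)
Lemma row_comm i j : i != z -> j != z -> i != j ->
  [/\ forall u, u != z -> T i u z = T i j z * (u == j)%:R,
      (forall u, u != z -> u != i -> u != j -> T i j z = 0),
      3%:R * T i j z = 0
    & T i j z = 0 -> T j i z = 0 -> forall v, v != z -> T i j v = T j i v].
Proof.
move=> iz jz ij; have zi : z != i by rewrite eq_sym.
have zj : z != j by rewrite eq_sym.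
have [c e] := yy_entry zi zj iz zj.
have ez := e z z; have eji := e j j; have eij := e i i.
move: ez eji eij; simp_eq => ez eji eij.
split=> [u uz|u uz ui uj||t1 t2 v vz].
- by have := e u j; simp_eq=> ->; rewrite eji.
- by have := e u u; simp_eq => ce; rewrite eji -ce.
- by rewrite eji in ez *; lc2 ez (-1 : k) eij (-1 : k).
have := e z v; rewrite eji in t1; rewrite t1 !Tzz //; simp_eq.
by move/eqP; rewrite opprK addrC subr_eq0 => /eqP.
Qed.

(** The diagonal matrix with -1 at z and i commutes with x_zi, so in odd
    characteristic the entries of T i between the two eigenspaces vanish. If
    n = 3 and p = 3, [row_comm] does not determine them. *)
Lemma torus_entry i j : i != z -> j != z -> i != j -> (2%:R : k) != 0 ->
  T i j z = 0 /\ T i i j = 0.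
Proof.
move=> iz jz ij two; have zi : z != i by rewrite eq_sym.
have [h Hh rh] := torus zi; pose d := \row_l (-1 : k) ^+ ((l == z) || (l == i)).
have dE A u v : (A *m r h) u v = A u v * d 0 v by rewrite rh mul_mx_diag mxE.
have Ed A u v : (r h *m A) u v = d 0 u * A u v by rewrite rh mul_diag_mx mxE.
have hy : commute (y z i) h.
  apply: rI; rewrite ?groupM ?yH // !rM ?yH // ry //.
  apply/matrixP=> u v; rewrite dE Ed !transvE !mxE.
  have [->|uv] := eqVneq u v; first by ring.
  by have [->|?] := eqVneq u z; have [->|?] := eqVneq v i; simp_eq;
  rewrite /= ?expr0 ?expr1; ring.
have [c e] := dD (yH zi) Hh; have [c' e'] := dD Hh (yH zi).
move: e; rewrite hy e' rM ?yH // ry // => e.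
have eE u v := congr1 (fun A : 'M[k]_n => A u v) e.
have := eE i j; have := eE j z.
rewrite /= !mx_linE !(dE, Ed, mul_mx_transv, mul_transv_mx) !mxE; simp_eq.
rewrite /= ?expr0 ?expr1 => e1 e2.
split; apply: (mulfI two); first by lc e1 (1 : k).
by lc e2 (-1 : k).
Qed.

(** 3 T = 0 gives T = 0 in characteristic 2; otherwise the torus applies. *)
Lemma T_colz_ne i j : i != z -> j != z -> i != j -> T i j z = 0.
Proof.
move=> iz jz ij; have [_ tz t3 _] := row_comm iz jz ij.
have [two|two] := eqVneq (2%:R : k) 0; last by have [] := torus_entry iz jz ij two.
by lc2 t3 (1 : k) two (- T i j z).
Qed.

Lemma T_colz i u : i != z -> u != z -> T i u z = 0.
Proof.
move=> iz uz; have [->{u uz}|ui] := eqVneq u i; last by rewrite T_colz_ne // eq_sym.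
have [j /andP[jz ji]] := ex_third z i n_gt2; have ij : i != j by rewrite eq_sym.
have [e _ _ _] := row_comm iz jz ij; rewrite e //.
by rewrite (negbTE ij) mulr0.
Qed.

Lemma T_sym i j v : i != z -> j != z -> v != z -> T i j v = T j i v.
Proof.
move=> iz jz vz; have [->//|ij] := eqVneq i j.
by have [_ _ _ e] := row_comm iz jz ij; exact: (e (T_colz iz jz) (T_colz jz iz) v vz).
Qed.

(** For a, b different from z and i different from a, x_ab commutes with x_zi.
    The auxiliary values D(x_ab) enter these equations only through the column z,
    and are eliminated afterwards. *)
Lemma levi_entry a b : a != z -> b != z -> a != b ->
  forall i u v, i != z -> i != a -> u != z -> v != z ->
    T i u a * (v == b)%:R - (u == a)%:R * T i b v - D (y a b) u z * (v == i)%:R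
  = D (y a b) i z * ((u == v)%:R + ((u == a) && (v == b))%:R).
Proof.
move=> az bz ab i u v iz ia uz vz; have zb : z != b by rewrite eq_sym.
have zi : z != i by rewrite eq_sym.
have [c e] := yy_entry zi ab ia zb; have := e z z; have := e u v.
by simp_eq => -> <-; rewrite opprK.
Qed.

(** With three indices off z, the relations with x_li and x_lj suffice. The
    entry T j i l is an entry of D(x_li) that equals its own opposite; in
    characteristic 2 the relation x_zj(1)^2 = 1 replaces this. *)
Lemma T_offdiag_third i j l : i != z -> j != z -> l != z -> i != j -> i != l ->
  j != l -> [/\ T j j l = 0, T j i l = 0 & T j l l = T j i i].
Proof.
move=> iz jz lz ij il jl; have li : l != i by rewrite eq_sym.
have lj : l != j by rewrite eq_sym. have ji : j != i by rewrite eq_sym.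
have e := levi_entry lz iz li; have e' := levi_entry lz jz lj.
have ejji := e j j i jz jl jz iz; have ejjj := e j j j jz jl jz jz.
have ejii := e j i i jz jl iz iz; have ejli := e j l i jz jl lz iz.
have eili := e' i l i iz il lz iz; have ejlj := e' j l j jz jl lz jz.
have ejll := e' j l l jz jl lz lz.
move: ejji ejjj ejii ejli eili ejlj ejll; simp_eq.
set Z := D (y l i); set Z' := D (y l j) => e1 e2 e3 e4 e5 e6 e7.
have t : T j i l = 0.
  have [two|two] := eqVneq (2%:R : k) 0; last first.
    by rewrite e3; apply: (mulfI two); lc e2 (-1 : k).
  have tj := char2_square two jz jz; have tij := T_sym iz jz iz.
  rewrite tj e1 in e6 e7; rewrite -tij -e3 in e4.
  have z' : Z' l z = - T i j i by lc e5 (-1 : k).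
  rewrite -e7 z' in e6; rewrite -e4.
  by lc2 e6 (1 : k) two (- T i j i).
split=> //.
by rewrite -e3 t in e4; lc e4 (1 : k).
Qed.

Lemma T_diag_third i j l : i != z -> j != z -> l != z -> i != j -> i != l ->
  j != l -> T j j j = 2%:R * T j i i.
Proof.
move=> iz jz lz ij il jl; have li : l != i by rewrite eq_sym.
have lj : l != j by rewrite eq_sym. have ji : j != i by rewrite eq_sym.
have e' := levi_entry lz jz lj; have [t1 t2 t3] := T_offdiag_third iz jz lz ij il jl.
have eili := e' i l i iz il lz iz; have ejlj := e' j l j jz jl lz jz.
have ejll := e' j l l jz jl lz lz; have s : T i j i = T j i i by apply: T_sym.
move: eili ejlj ejll; simp_eq; rewrite t1 t3 s => e5 e6 e7.
rewrite -e7 oppr0 in e6.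
by lc2 e5 (1 : k) e6 (-1 : k).
Qed.

Lemma T_offdiag i j : i != z -> j != z -> i != j -> T j j i = 0.
Proof.
move=> iz jz ij.
case: (pickP (fun l : 'I_n => [&& l != z, l != i & l != j])) => [l|no].
  case/and3P=> lz li lj; have il : i != l by rewrite eq_sym.
  have jl : j != l by rewrite eq_sym. have ji : j != i by rewrite eq_sym.
  by have [] := T_offdiag_third lz jz iz lj li ji.
have [two|two] := eqVneq (2%:R : k) 0; first exact: char2_square.
have ji : j != i by rewrite eq_sym.
by have [] := torus_entry jz iz ji two.
Qed.

(** If z, i, j are the only indices, the relation [x_zi, x_ij] = x_zj is needed,
    together with the torus. *)
Lemma T_diag i j : i != z -> j != z -> i != j -> T j j j = 2%:R * T j i i.
Proof.
move=> iz jz ij.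
case: (pickP (fun l : 'I_n => [&& l != z, l != i & l != j])) => [l|no].
  case/and3P=> lz li lj; have il : i != l by rewrite eq_sym.
  by apply: (T_diag_third iz jz lz ij il); rewrite eq_sym.
have [two|two] := eqVneq (2%:R : k) 0; first by rewrite two mul0r char2_square.
have ji : j != i by rewrite eq_sym.
have zi : z != i by rewrite eq_sym. have zj : z != j by rewrite eq_sym.
have [c e] := commutator_entry rM dD (yH zi) (yH ij) (yH zj)
  (ry zi) (ry ij) (etrans (ry zj) (congr1 _ (esym (mulr1 1))))
  (y_commutator zi ij zj) zi ij zj.
have := e i i; have := e z z; have e1 := levi_entry iz jz ij.
have := e1 j j j jz ji jz jz; have := e1 j i j jz ji iz jz; simp_eq.
rewrite !Tzz // !T_colz // (T_offdiag iz jz ij); simp_eq => e2 e3 e4 e5.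
have zj0 : D (y i j) j z = 0 by apply: (mulfI two); lc e3 (-1 : k).
have s : T i j i = T j i i by apply: T_sym.
have zi0 : D (y i j) i z = - T j i i.
  by rewrite s -e4 in e5; apply: (mulfI two); lc e5 (-1 : k).
by rewrite zj0 zi0 in e2; lc e2 (-1 : k).
Qed.

(** The result of the preceding relations: off row and column z, the values
    T i are those of the commutator with a matrix whose column z is c, up
    to scalars. *)
Lemma row_formula : exists c : 'I_n -> k, forall i u v,
  i != z -> u != z -> v != z ->
  T i u v = c u * (v == i)%:R + c i * (u == v)%:R.
Proof.
pose c i := if [pick o | (o != z) && (o != i)] is Some o then T i o o else 0.
have cE i o : i != z -> o != z -> o != i -> T i o o = c i.
  move=> iz oz oi; rewrite /c; case: pickP => [o' /andP[o'z o'i] | /(_ o)]; last first.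
    by rewrite oz oi.
  have [->//|oo'] := eqVneq o o'; have io' : i != o' by rewrite eq_sym.
  by have [_ _ ->] := T_offdiag_third oz iz o'z oi oo' io'.
exists c => i u v iz uz vz; have [->|ui] := eqVneq u i; last first.
  have [->|vi] := eqVneq v i; first by rewrite (T_sym iz uz iz) cE 1?eq_sym //; simp_eq.
  have [<-|uv] := eqVneq u v; first by rewrite cE //; simp_eq.
  have iv : i != v by rewrite eq_sym.
  by have [_ -> _] := T_offdiag_third uz iz vz ui uv iv; simp_eq.
have [o /andP[oz oi]] := ex_third z i n_gt2.
have [->|vi] := eqVneq v i; first by rewrite (T_diag oz iz oi) (cE i o) //; simp_eq; ring.
by rewrite (T_offdiag vz iz vi); simp_eq.
Qed.

(** The matrix X is read off: its column z is given by the c of [row_formula],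
    and the rest absorbs the free row z of the T i. *)
Lemma row_normalised : exists X : 'M[k]_n, forall i, i != z ->
  exists c : k, D (y z i) = X *m r (y z i) - r (y z i) *m X + c *: r (y z i).
Proof.
have [c cE] := row_formula.
exists (\matrix_(u, v) if v == z then (if u == z then 0 else c u)
   else if u == z then 0 else c u * (u == v)%:R - D (y z u) z v).
move=> i iz; exists (c i); have zi : z != i by rewrite eq_sym.
apply/matrixP=> u v; rewrite ry // !mx_linE mul_mx_transv mul_transv_mx !mxE.
have [->|uz] := eqVneq u z; have [->|vz] := eqVneq v z; simp_eq.
- by rewrite Tzz //; ring.
- by rewrite (eq_sym v i); case: (i == v) => /=; ring.
- by rewrite T_colz //; ring.
- by rewrite cE //; ring.
Qed.

End NormalisedRow.

Section RowInner.

Variables (k : fieldType) (gT : finGroupType) (H : {group gT}).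
Variables (n : nat) (r : gT -> 'M[k]_n) (D : gT -> 'M[k]_n).
Hypothesis n_gt2 : (2 < n)%N.
Hypothesis rM : {in H &, forall g h, r (g * h)%g = r g *m r h}.
Hypothesis rI : {in H &, injective r}.
Variable y : 'I_n -> 'I_n -> gT.
Hypothesis yH : forall i j, i != j -> y i j \in H.
Hypothesis ry : forall i j, i != j -> r (y i j) = transv i j 1.
Hypothesis torus : forall z i, z != i ->
  exists2 h, h \in H & r h = diag_mx (\row_l (-1) ^+ ((l == z) || (l == i))).
Hypothesis dD : proj_der H r D.

Lemma row_inner z : exists X : 'M[k]_n, forall i, i != z ->
  exists c : k, D (y z i) = X *m r (y z i) - r (y z i) *m X + c *: r (y z i).
Proof.
have dD' := proj_derZ rM (fun g => - D g z z) dD.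
have := row_normalised n_gt2 rM rI yH ry torus dD' (z := z).
case=> [i iz|X XE].
  by rewrite ry 1?eq_sym // !mx_linE !mxE; simp_eq; rewrite subrr.
exists X => i /XE[c e]; exists (c + D (y z i) z z); rewrite scalerDl addrA -e.
by rewrite scaleNr addrNK.
Qed.

End RowInner.

(** * Derivations on all root elements *)

Lemma natr_card_finField (F : finFieldType) : #|F|%:R = 0 :> F.
Proof. by rewrite -FinRing.zmodXgE -cardsT expg_cardG ?inE. Qed.

Section AllRoots.

Variables (k : fieldType) (gT : finGroupType) (H : {group gT}).
Variables (n : nat) (r : gT -> 'M[k]_n).
Hypothesis n_gt2 : (2 < n)%N.
Hypothesis rM : {in H &, forall g h, r (g * h)%g = r g *m r h}.
Hypothesis rI : {in H &, injective r}.
Variables (F : finFieldType) (s : {rmorphism F -> k}).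
Variable x : 'I_n -> 'I_n -> F -> gT.
Hypothesis xH : forall i j a, i != j -> x i j a \in H.
Hypothesis rx : forall i j a, i != j -> r (x i j a) = transv i j (s a).
Hypothesis torus : forall z i, z != i ->
  exists2 h, h \in H & r h = diag_mx (\row_l (-1) ^+ ((l == z) || (l == i))).

Local Notation y i j := (x i j 1).

Let yH i j : i != j -> y i j \in H. Proof. exact: xH. Qed.

Let ry i j : i != j -> r (y i j) = transv i j 1.
Proof. by move=> ij; rewrite rx // rmorph1. Qed.

Definition null (D : gT -> 'M[k]_n) g := exists c : k, D g = c *: r g.

Lemma r_diag i j a u : i != j -> r (x i j a) u u = 1.
Proof.
move=> ij; rewrite rx // transvE eqxx; case: eqP => [->|_] /=.
  by rewrite (negbTE ij) mulr0 addr0.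
by rewrite mulr0 addr0.
Qed.

(** A derivation is only relevant modulo multiples of r, and the entry (z, z) of
    every root element is 1, so a multiple of r may be subtracted that makes all
    entries (z, z) of D zero; being null then means being zero. *)
Lemma normalise_null D g z i j a : g = x i j a -> i != j -> null D g ->
  D g + - D g z z *: r g = 0.
Proof.
move=> -> ne [c ->]; rewrite !mx_linE r_diag // mulr1.
by rewrite scaleNr subrr.
Qed.

Lemma normalised_null D g c : D g + c *: r g = 0 -> null D g.
Proof. move=> /eqP; rewrite addr_eq0 => /eqP e; by exists (- c); rewrite scaleNr. Qed.

(** As D vanishes on row z, the terms in D(x_zi) drop out of the relations between
    x_ab and the x_zi, and what remains determines D(x_ab) off row z up to a
    multiple of r. *)
Lemma zero_row_shape D z : proj_der H r D ->
    (forall i, i != z -> D (y z i) = 0) ->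
  forall a b, a != z -> b != z -> a != b ->
  exists c : k, forall u v, (u != z) || (v == z) ->
    D (y a b) u v = c * r (y a b) u v.
Proof.
move=> dD Dz a b az bz ab.
have zb : z != b by rewrite eq_sym. have za : z != a by rewrite eq_sym.
have rows i : i != z -> i != a ->
    (forall u, u != z -> D (y a b) u z = 0) /\
    (forall v, D (y a b) i v = D (y a b) z z * (v == i)%:R).
  move=> iz ia; have zi : z != i by rewrite eq_sym.
  have [c e] := yy_entry rM rI yH ry dD zi ab ia zb.
  have := e a a; rewrite Dz // !mxE; simp_eq => c0E.
  split=> [u uz|v].
    by have := e u i; rewrite Dz // -c0E !mxE; simp_eq => e1; lc e1 (-1 : k).
  have := e z v; rewrite Dz // -c0E !mxE; simp_eq => e1; lc e1 (1 : k).
have [i /andP[iz ia]] := ex_third z a n_gt2.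
have [col _] := rows i iz ia.
have [c e] := commutator_entry rM dD (yH za) (yH ab) (yH zb)
  (ry za) (ry ab) (etrans (ry zb) (congr1 _ (esym (mulr1 1))))
  (y_commutator rM rI yH ry za ab zb) za ab zb.
have := e a a; rewrite !Dz // !mxE; simp_eq; rewrite !col //; simp_eq => cE.
exists (D (y a b) z z) => u v; rewrite ry // !mxE.
have [->{u}/= /eqP->|uz _] := eqVneq u z; first by simp_eq.
have [->{u uz}|ua] := eqVneq u a; last first.
  by have [_ ->] := rows u uz ua; simp_eq; rewrite eq_sym.
have := e z v; rewrite !Dz // -cE !mxE; simp_eq => ->.
by rewrite (eq_sym a v); ring.
Qed.

Lemma null_row_shape D z : proj_der H r D ->
    (forall i, i != z -> null D (y z i)) ->
  forall a b, a != z -> b != z -> a != b ->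
  exists c : k, forall u v, (u != z) || (v == z) ->
    D (y a b) u v = c * r (y a b) u v.
Proof.
move=> dD0 Dz0 a b az bz ab; pose c0 g := - D g z z.
have [i iz|c cE] := zero_row_shape (proj_derZ rM c0 dD0) _ az bz ab.
  apply: (@normalise_null _ _ _ z i 1) => //=; first by rewrite eq_sym.
  exact: Dz0.
exists (c - c0 (y a b)) => u v uv; have := cE u v uv; rewrite !mx_linE => e.
by lc e (1 : k).
Qed.

(** Let X make D inner on row u. By [null_row_shape] D(x_uj) is a
    multiple of r outside row o, so the rows of X other than o and u are those of
    a scalar matrix. Row o of X, off the diagonal, gives a matrix X' that
    commutes with the x_oi. Subtracting its commutator keeps D null on row o and
    makes it null on row u, except for a multiple of E_uo in D(x_uo), which is
    zero by the relation [x_uo, x_ow] = x_uw. *)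
Lemma null_two_rows D o u : o != u -> proj_der H r D ->
    (forall i, i != o -> null D (y o i)) ->
  exists X, let D' g := D g - (X *m r g - r g *m X) in
    (forall i, i != o -> null D' (y o i)) /\
    (forall j, j != u -> null D' (y u j)).
Proof.
move=> ou dD Do; have uo : u != o by rewrite eq_sym.
have [X XE] := row_inner n_gt2 rM rI yH ry torus dD u.
pose X' := \matrix_(a, b) (if (a == o) && (b != o) then X a b else 0).
exists X'; set D' := fun g => _; have dD' : proj_der H r D' := proj_derB rM X' dD.
have X0 j : j != o -> j != u ->
    (forall a, a != o -> a != u -> X a u = 0)
    /\ (forall b, X j b = X u u * (b == j)%:R).
  move=> jo ju; have uj : u != j by rewrite eq_sym.
  have [c cE] := null_row_shape dD Do uo jo uj; have [d dE] := XE j ju.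
  have oj : o != j by rewrite eq_sym.
  have eE a b := congr1 (fun A : 'M[k]_n => A a b) dE.
  have := eE o o; rewrite /= cE ?eqxx ?orbT // ry // !mx_linE.
  rewrite mul_mx_transv mul_transv_mx !mxE; simp_eq => cd.
  have {eE}eE a b : a != o -> X a u * (b == j)%:R = (a == u)%:R * X j b.
    move=> ao; have := eE a b; rewrite /= cE ?ao // ry // !mx_linE.
    rewrite mul_mx_transv mul_transv_mx !mxE => e.
    by rewrite cd in e; lc e (-1 : k).
  split=> [a ao au|b]; first by have := eE a j ao; simp_eq.
  by have := eE u b uo; simp_eq.
have [w /andP[wo wu]] := ex_third o u n_gt2.
have [Xu0 _] := X0 w wo wu.
have XD j (ju : j != u) : exists c : k,
    D' (y u j) = (X u u - X o o) * (j == o)%:R *: delta_mx u j + c *: r (y u j).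
  have [d dE] := XE j ju; have uj : u != j by rewrite eq_sym.
  exists d; rewrite /D' dE ry //; apply/matrixP=> a b.
  rewrite !mx_linE !mul_mx_transv !mul_transv_mx !mxE.
  have [->{j ju uj dE}|jo] := eqVneq j o; last first.
    have [_ Xj] := X0 j jo ju; rewrite Xj; simp_eq.
    have [->|ao] := eqVneq a o; first by simp_eq; ring.
    have [->|au] := eqVneq a u; first by simp_eq; ring.
    by rewrite (Xu0 a) //; simp_eq; ring.
  have [->|ao] := eqVneq a o; first by simp_eq; case: (b == o) => /=; ring.
  have [->|au] := eqVneq a u; first by have [->|bo] := eqVneq b o; simp_eq; ring.
  by rewrite (Xu0 a) //; simp_eq; ring.
have D'o i : i != o -> null D' (y o i).
  move=> io; have oi : o != i by rewrite eq_sym.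
  have [c cE] := Do i io; exists c; rewrite /D' cE ry //.
  apply/matrixP=> a b.
  rewrite !mx_linE !mul_mx_transv !mul_transv_mx !mxE.
  by simp_eq; case: (a == o) => /=; ring.
have D'u j : j != u -> j != o -> null D' (y u j).
  move=> ju jo; have [c cE] := XD j ju; exists c.
  by rewrite cE (negbTE jo) mulr0 scale0r add0r.
split=> // j ju; have [->{j ju}|jo] := eqVneq j o; last exact: D'u.
have [c cE] := XD o ou; exists c; rewrite cE.
suff -> : X u u - X o o = 0 by rewrite mul0r scale0r add0r.
have [ow uw] : o != w /\ u != w by rewrite !(eq_sym _ w).
pose c0 g := - D' g o o; pose D2 g := D' g + c0 g *: r g.
have dD2 : proj_der H r D2 := proj_derZ rM c0 dD'.
have D2h : D2 (y o w) = 0.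
  by apply: (@normalise_null _ _ _ o w 1) => //; apply: D'o.
have D2t : D2 (y u w) = 0.
  by apply: (@normalise_null _ _ _ u w 1) => //; apply: D'u.
have D2g : D2 (y u o) = (X u u - X o o) *: delta_mx u o.
  rewrite /D2 /c0 cE ry // !mx_linE !mxE; simp_eq.
  by apply/matrixP=> a b; rewrite !mxE; simp_eq; ring.
have [e eE] := commutator_entry rM dD2 (yH uo) (yH ow) (yH uw)
  (ry uo) (ry ow) (etrans (ry uw) (congr1 _ (esym (mulr1 1))))
  (y_commutator rM rI yH ry uo ow uw) uo ow uw.
have := eE w w; have := eE u w; rewrite D2h D2t D2g !mxE; simp_eq => -> <-.
by [].
Qed.

(** Normalise D at (u, u). By [zero_row_shape] for o, D(x_ab) is zero outside
    row o if a and b differ from o, and likewise for u; this leaves nothing if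
    both apply. The remaining x_io and x_iu are tied by [x_io, x_ou] = x_iu. *)
Lemma null_prime_roots D o u : o != u -> proj_der H r D ->
    (forall i, i != o -> null D (y o i)) ->
    (forall i, i != u -> null D (y u i)) ->
  forall i j, i != j -> null D (y i j).
Proof.
move=> ou dD0 Do0 Du0; have uo : u != o by rewrite eq_sym.
pose c0 g := - D g u u.
suff: forall i j, i != j -> D (y i j) + c0 (y i j) *: r (y i j) = 0.
  by move=> h i j /h; apply: normalised_null.
have := proj_derZ rM c0 dD0; set D' := fun g => _ => dD.
have Do i : i != o -> D' (y o i) = 0.
  by move=> io; apply: (@normalise_null _ _ _ o i 1); rewrite // 1?eq_sym //; exact: Do0.
have Du i : i != u -> D' (y u i) = 0.
  by move=> io; apply: (@normalise_null _ _ _ u i 1); rewrite // 1?eq_sym //; exact: Du0.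
have Duu i j : i != j -> D' (y i j) u u = 0.
  by move=> ij; rewrite /D' /c0 !mx_linE r_diag // mulr1 subrr.
suff: forall i j, i != j -> D' (y i j) = 0 by [].
clearbody D'; clear D c0 dD0 Do0 Du0.
have rowo a b : a != o -> b != o -> a != b ->
    forall v w, (v != o) || (w == o) -> D' (y a b) v w = 0.
  move=> ao bo ab v w vw; have [c cE] := zero_row_shape dD Do ao bo ab.
  have := cE u u; rewrite uo Duu // r_diag // mulr1 => /(_ isT) c0.
  by rewrite cE // -c0 mul0r.
have rowu a b : a != u -> b != u -> a != b ->
    forall v w, (v != u) || (w == u) -> D' (y a b) v w = 0.
  move=> ao bo ab v w vw; have [c cE] := zero_row_shape dD Du ao bo ab.
  have := cE u u; rewrite eqxx orbT Duu // r_diag // mulr1 => /(_ isT) c0.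
  by rewrite cE // -c0 mul0r.
have corner i : i != o -> i != u -> D' (y i o) = 0 /\ D' (y i u) = 0.
  move=> io iu; set Y := D' (y i o); set Y' := D' (y i u).
  have Yu v w : (v != u) || (w == u) -> Y v w = 0 by apply: rowu.
  have Yo v w : (v != o) || (w == o) -> Y' v w = 0 by apply: rowo.
  have [e eE] := commutator_entry rM dD (yH io) (yH ou) (yH iu)
    (ry io) (ry ou) (etrans (ry iu) (congr1 _ (esym (mulr1 1))))
    (y_commutator rM rI yH ry io ou iu) io ou iu.
  have := eE i o; rewrite Do // -/Y -/Y' !mxE ?(Yu i) ?iu // ?(Yo i) ?io //.
  rewrite ?(Yo o o) ?eqxx // ?(Yo u) ?uo // ?(Yu o) ?ou //; simp_eq => e0.
  have Y'o w : Y' o w = 0.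
    have := eE i w; rewrite Do // -/Y -/Y' !mxE ?(Yu i) ?iu // ?(Yo i) ?io // -e0.
    by rewrite ?(Yu o) ?ou //; simp_eq => <-.
  have Yu' w : Y u w = 0.
    have := eE o w; rewrite Do // -/Y -/Y' !mxE ?(Yu o) ?ou // ?Y'o // -e0.
    rewrite ?(Yo u) ?uo // ?(Yo i) ?io //; simp_eq.
    have [->|wu] := eqVneq w u; first by rewrite (Yu u u) ?eqxx ?orbT.
    by simp_eq => <-.
  split; apply/matrixP=> v w; rewrite mxE.
    by have [->|vu] := eqVneq v u; rewrite ?Yu' // Yu // vu.
  by have [->|vo] := eqVneq v o; rewrite ?Y'o // Yo // vo.
move=> i j; have [->|io] := eqVneq i o; first by move=> oj; rewrite Do // eq_sym.
have [->|iu] := eqVneq i u => [uj|ij]; first by rewrite Du // eq_sym.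
have [->|jo] := eqVneq j o; first by have [] := corner i io iu.
have [->|ju] := eqVneq j u; first by have [] := corner i io iu.
apply/matrixP=> v w; rewrite mxE; have [->|vo] := eqVneq v o.
  by rewrite rowu // ou.
by rewrite rowo // vo.
Qed.

(** Commuting with enough x_cd(1) forces D(x_ij(a)) to be a multiple of E_ij. The
    coefficient vanishes at a = 1, and the relations [x_ij(a), x_jl(b)] = x_il(ab)
    make it a derivation in a with values in k. As a^q = a, it vanishes: its
    value at a^q is q a^(q-1) times its value at a, and q = 0 in k. *)
Lemma null_all_roots D : proj_der H r D ->
    (forall i j, i != j -> null D (y i j)) ->
  forall i j a, i != j -> null D (x i j a).
Proof.
move=> dD0 Dy0 i j a; pose o := j; pose c0 g := - D g o o.
suff h : i != j -> D (x i j a) + c0 (x i j a) *: r (x i j a) = 0.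
  by move=> /h; apply: normalised_null.
have := proj_derZ rM c0 dD0; set D' := fun g => _ => dD.
have Dy l m : l != m -> D' (y l m) = 0.
  by move=> lm; apply: (@normalise_null _ _ _ l m 1); rewrite //; exact: Dy0.
have Doo l m b : l != m -> D' (x l m b) o o = 0.
  by move=> lm; rewrite /D' /c0 !mx_linE r_diag // mulr1 subrr.
suff: i != j -> D' (x i j a) = 0 by [].
clearbody D' o; clear D c0 dD0 Dy0.
(* only the entry (l, m) of D(x_lm(b)) survives *)
have shape l m b u v : l != m -> (u != l) || (v != m) -> D' (x l m b) u v = 0.
  move=> lm uv; set Y := D' _.
  have rel c d : c != d -> m != c -> l != d ->
      (forall e, e != c -> Y e c = 0) /\ (forall e, Y d e = Y c c * (e == d)%:R).
    move=> cd mc ld; have clm : commute (x l m b) (y c d).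
      apply: rI; rewrite ?groupM ?xH //.
      by rewrite !rM ?xH // !rx // transv_comm.
    have [e eE] := comm_entry rM dD (xH b lm) (yH cd) (rx b lm) (ry cd) clm mc.
    have [w /andP[wc wd]] := ex_third c d n_gt2.
    have lmw : (w == l) && (w == m) = false.
      by apply/negbTE/andP=> -[/eqP-> /eqP E]; rewrite E eqxx in lm.
    have := eE w w; rewrite (Dy c d) // -/Y !mxE lmw; simp_eq => e0.
    split=> [f fc|f].
      by have := eE f d; rewrite (Dy c d) // -/Y -e0 !mxE; simp_eq.
    have := eE c f; rewrite (Dy c d) // -/Y -e0 !mxE; simp_eq => e1.
    by lc e1 (-1 : k).
  have diag w : w != l -> Y w w = Y l l.
    move=> wl; have lw : l != w by rewrite eq_sym.
    have ml : m != l by rewrite eq_sym.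
    by have [_ ->] := rel l w lw ml lw; simp_eq.
  have Yd : Y l l = 0.
    have [ol|ol] := eqVneq o l; first by rewrite -{1 2}ol Doo.
    by rewrite -(diag o ol) Doo.
  have [<-|vu] := eqVneq v u.
    by have [->|/diag->] := eqVneq v l.
  have [ul|ul] := eqVneq u l; last first.
    have [c /andP[cm cu]] := ex_third m u n_gt2.
    have mc : m != c by rewrite eq_sym.
    have lu : l != u by rewrite eq_sym.
    have [_ ->] := rel c u cu mc lu; simp_eq.
    by [].
  rewrite ul eqxx /= in uv; have [d /andP[dv dl]] := ex_third v l n_gt2.
  have vd : v != d by rewrite eq_sym. have ld : l != d by rewrite eq_sym.
  have mv : m != v by rewrite eq_sym.
  by have [h _] := rel v d vd mv ld; apply: h; rewrite eq_sym.
pose p' l m b := D' (x l m b) l m.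
have pE l m b : l != m -> D' (x l m b) = p' l m b *: delta_mx l m.
  move=> lm; apply/matrixP=> u v; rewrite !mxE.
  have [->|ul] := eqVneq u l; last by rewrite shape ?ul // mulr0.
  have [->|vm] := eqVneq v m; first by rewrite mulr1.
  by rewrite shape ?vm ?orbT // mulr0.
have p1 l m : l != m -> p' l m 1 = 0 by move=> lm; rewrite /p' Dy // mxE.
(* the Leibniz rule, spread over three roots *)
have pM e l m b c : e != l -> l != m -> e != m ->
    p' e m (b * c) = s c * p' e l b + s b * p' l m c.
  move=> el lm em.
  have elm : (x e l b * x l m c = x l m c * x e l b * x e m (b * c)%R)%g.
    apply: rI; rewrite ?groupM ?xH //.
    by rewrite !rM ?groupM ?xH // !rx // transv_commutator // rmorphM.
  have [d dE] := commutator_entry rM dD (xH b el) (xH c lm) (xH (b * c) em)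
    (rx b el) (rx c lm) (etrans (rx (b * c) em) (congr1 _ (rmorphM s b c))) elm el lm em.
  have := dE l l; have := dE e m; rewrite !pE // !mxE; simp_eq => e1 e2.
  by rewrite -e2 in e1; lc e1 (-1 : k).
move=> ij; rewrite pE //; suff -> : p' i j a = 0 by rewrite scale0r.
have [l /andP[li lj]] := ex_third i j n_gt2; have il : i != l by rewrite eq_sym.
have der b c : p' i j (b * c) = s c * p' i j b + s b * p' i j c.
  have -> : p' i j b = p' i l b.
    by rewrite -[in LHS](mulr1 b) (pM i l) ?p1 // rmorph1 mul1r mulr0 addr0.
  rewrite (pM i l) //; congr (_ + _ * _).
  by rewrite -[in RHS](mul1r c) (pM i l) ?p1 // rmorph1 mul1r mulr0 add0r.
have derX m : p' i j (a ^+ m.+1) = m.+1%:R * s a ^+ m * p' i j a.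
  elim: m => [|m IH]; first by rewrite expr1 expr0 !mul1r.
  by rewrite exprS der IH rmorphXn /= !exprS -[m.+2]addn1 natrD; ring.
have F_gt0 : (0 < #|F|)%N by apply/card_gt0P; exists 0.
have qF : #|F|%:R = 0 :> k by rewrite -(rmorph_nat s) natr_card_finField rmorph0.
have := derX #|F|.-1; rewrite (prednK F_gt0) expf_card qF => ->.
by rewrite !mul0r.
Qed.

Lemma null_roots D : proj_der H r D -> exists X, forall i j a, i != j ->
  null (fun g => D g - (X *m r g - r g *m X)) (x i j a).
Proof.
move=> dD; pose o := Ordinal (ltnW (ltnW n_gt2)); have [u /andP[uo _]] := ex_third o o n_gt2.
have ou : o != u by rewrite eq_sym.
have [X1 X1E] := row_inner n_gt2 rM rI yH ry torus dD o.
have dD1 := proj_derB rM X1 dD.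
have [i io|X2 [D2o D2u]] := null_two_rows ou dD1.
  by have [c cE] := X1E i io; exists c; rewrite cE addrAC subrr add0r.
have dD2 := proj_derB rM X2 dD1.
have D2 := null_prime_roots ou dD2 D2o D2u.
exists (X1 + X2) => i j a ij; have [c cE] := null_all_roots dD2 D2 a ij.
exists c; rewrite -cE mulmxDl mulmxDr.
by apply/matrixP=> v w; rewrite !mx_linE; ring.
Qed.

End AllRoots.

(** * Root elements in small degree *)

(** Stated for a family of elements in an arbitrary group, so that the results
    apply alike to the transposed family and to relabelled indices. *)
Record steinberg (F : finFieldType) (gT : finGroupType) n
    (x : 'I_n -> 'I_n -> F -> gT) : Prop := Steinberg {
  steinbergD : forall i j a b, i != j -> x i j (a + b) = (x i j a * x i j b)%g;
  steinberg_commute : forall i j l m a b, i != j -> l != m -> j != l -> i != m ->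
    commute (x i j a) (x l m b);
  steinberg_commg : forall i j l a b, i != j -> j != l -> i != l ->
    [~ x i j a, x j l b] = x i l (a * b) }.

(** By Cauchy's theorem: an element of prime order of the quotient lifts, modulo
    its p'-part, to a p-element. *)
Lemma quotient_p'elts_pgroup (gT : finGroupType) (p : nat) (Q N : {group gT}) :
    Q \subset 'N(N) -> (forall y, y \in Q -> p^'.-elt y -> y \in N) ->
  p.-group (Q / N)%g.
Proof.
move=> nNQ p'N; apply/pgroupP=> q q_pr /(Cauchy q_pr)[_ /morphimP[y Ny Qy ->] oy].
have Qc (pi : nat_pred) : y.`_pi \in Q by exact: groupX.
have Nc (pi : nat_pred) : y.`_pi \in 'N(N) by apply: (subsetP nNQ).
have cy : coset N y = coset N y.`_p.
  rewrite -{1}(consttC p y) morphM //= (coset_id (p'N y.`_p^' _ _)) ?mulg1 //.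
  exact: p_elt_constt.
have : p.-elt (coset N y) by rewrite cy morph_p_elt ?p_elt_constt.
by rewrite /p_elt oy (pnatE _ q_pr).
Qed.

Section Unitriangular.

Variables (k : fieldType) (p : nat) (gT : finGroupType) (G : {group gT}).
Hypothesis pk : p \in [pchar k].
Variables (d : nat) (rG : mx_representation k G d) (U : 'M[k]_d).
Hypothesis Umod : mxmodule rG U.

Lemma rker_factmodP x : x \in G ->
  (x \in rker (factmod_repr Umod)) = (rG x - 1%:M <= U)%MS.
Proof.
move=> Gx; rewrite -(in_factmod_eq0 U).
have -> : in_factmod U (rG x - 1%:M)
    = in_factmod U 1%:M *m factmod_repr Umod x - in_factmod U 1%:M.
  by rewrite -in_factmodJ // mul1mx linearB.
rewrite subr_eq0.
apply/rkerP/eqP => [[_ ->]|e]; first by rewrite mulmx1.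
have vK : val_factmod 1%:M *m in_factmod U 1%:M = 1%:M.
  by rewrite -in_factmodE val_factmodK.
by split=> //; rewrite -[LHS]mul1mx -vK -mulmxA e.
Qed.

(** A p'-element acting trivially on U and on V/U satisfies (r(x) - 1)^2 = 0,
    hence x^p acts trivially, and x is a power of x^p. *)
Lemma p'elt_rker_ext x : x \in G -> p^'.-elt x ->
  x \in rker (submod_repr Umod) -> x \in rker (factmod_repr Umod) ->
  x \in rker rG.
Proof.
move=> Gx p'x; rewrite rker_submod inE Gx /= => /eqP Ux.
rewrite rker_factmodP // => /submxP[B eB]; pose N := rG x - 1%:M.
have NN : N *m N = 0.
  by rewrite {1}/N eB -mulmxA mulmxBr Ux mulmx1 subrr mulmx0.
have rxX j : rG (x ^+ j)%g = 1%:M + j%:R *: N.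
  elim: j => [|j IH]; first by rewrite repr_mx1 scale0r addr0.
  rewrite expgSr repr_mxM ?groupX // IH -[rG x](subrK 1%:M) -/N.
  rewrite mulmxDr mulmx1 mulmxDl mul1mx -scalemxAl NN scaler0 addr0.
  by rewrite -natr1 scalerDl scale1r [LHS]addrC -addrA.
have xp : (x ^+ p)%g \in rker rG.
  by apply/rkerP; split; [exact: groupX | rewrite rxX (pcharf0 pk) scale0r addr0].
have : generator <[x]> (x ^+ p)%g.
  by rewrite generator_coprime (pnat_coprime p'x) ?pnatNK ?pnat_id ?(pcharf_prime pk) //.
rewrite /generator => /eqP e; rewrite -cycle_subG e cycle_subG; exact: xp.
Qed.

End Unitriangular.

Section LowerBound.

Variables (F : finFieldType) (p : nat) (gT : finGroupType) (n : nat).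
Hypothesis pF : p \in [pchar F].
Variable x : 'I_n -> 'I_n -> F -> gT.
Hypothesis stx : steinberg x.

Lemma steinberg0 i j : i != j -> x i j 0 = 1%g.
Proof.
move=> ij; apply: (mulgI (x i j 0)).
by rewrite mulg1 -(steinbergD stx) // addr0.
Qed.

Lemma steinbergN i j a : i != j -> x i j (- a) = (x i j a)^-1%g.
Proof.
move=> ij; apply: (mulgI (x i j a)).
by rewrite mulgV -(steinbergD stx) // subrr steinberg0.
Qed.

Lemma steinbergMn i j a m : i != j -> x i j (a *+ m) = (x i j a ^+ m)%g.
Proof.
move=> ij; elim: m => [|m IH]; first by rewrite steinberg0.
by rewrite mulrS expgS (steinbergD stx) // IH.
Qed.

Definition root_group (m : nat) : {group gT} :=
  <<[set g | [exists i : 'I_n, [exists j : 'I_n, [exists a : F,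
      [&& (i < m)%N, (j < m)%N, i != j & g == x i j a]]]]]>>%G.

Lemma mem_root_group m (i j : 'I_n) a : (i < m)%N -> (j < m)%N -> i != j ->
  x i j a \in root_group m.
Proof.
move=> im jm ij; rewrite mem_gen // inE; apply/existsP; exists i.
by apply/existsP; exists j; apply/existsP; exists a; rewrite im jm ij eqxx.
Qed.

Lemma root_group_subP m (A : {group gT}) :
  (forall (i j : 'I_n) a, (i < m)%N -> (j < m)%N -> i != j -> x i j a \in A) ->
  root_group m \subset A.
Proof.
move=> h; rewrite gen_subG; apply/subsetP=> g; rewrite inE.
by case/existsP=> i /existsP[j /existsP[a /and4P[im jm ij /eqP->]]]; apply: h.
Qed.

(** Modulo N the group Q0 generated by x_ij(1) and x_ji(1) is a p-group, by
    [quotient_p'elts_pgroup]. It acts on Z = < x_il, x_jl > with [Z, Q0] = Z, by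
    the commutator relations. Since Q0 Z is nilpotent modulo N, Z becomes
    trivial there. *)
Lemma p'free_root_trivial (H N Q : {group gT}) i j l :
    N <| H -> Q \subset H -> i != j -> j != l -> i != l ->
    x i j 1 \in Q -> x j i 1 \in Q ->
    (forall a, x i l a \in H) -> (forall a, x j l a \in H) ->
    (forall y, y \in Q -> p^'.-elt y -> y \in N) ->
  forall a, x i l a \in N.
Proof.
move=> nNH sQH ij jl il Qij Qji Hil Hjl p'N; have ji : j != i by rewrite eq_sym.
have nNHs := normal_norm nNH.
pose Q0 := <<[set x i j 1%R; x j i 1%R]>>%G.
have sQ0 : Q0 \subset Q.
  by rewrite gen_subG; apply/subsetP=> g; rewrite !inE => /orP[]/eqP->.
pose ZA := [set x i l a | a : F] :|: [set x j l a | a : F]; pose Z := <<ZA>>%G.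
have ZiP a : x i l a \in Z by rewrite mem_gen // inE imset_f.
have ZjP a : x j l a \in Z by rewrite mem_gen // inE orbC imset_f.
have ZAP (P : gT -> Prop) : (forall a, P (x i l a)) -> (forall a, P (x j l a)) ->
    forall g, g \in ZA -> P g.
  by move=> h1 h2 g; rewrite inE => /orP[]/imsetP[a _ ->].
have sZH : Z \subset H.
  by rewrite gen_subG; apply/subsetP; apply: (ZAP _).
have abZ : abelian Z.
  have li : l != i by rewrite eq_sym.
  have lj : l != j by rewrite eq_sym.
  rewrite abelian_gen; apply/centsP; apply: (ZAP _) => a; apply: (ZAP _) => b;
    exact: steinberg_commute.
have pZ : p.-group Z.
  have abZA : abelian ZA by rewrite -abelian_gen.
  rewrite -pnat_exponent /= (abelian_exponent_gen abZA).
  apply: (@pnat_dvd _ (p ^ 1)); last exact: pnat_id (pcharf_prime pF).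
  by apply/exponentP; apply: (ZAP _) => a;
    rewrite -steinbergMn // -mulr_natl (pcharf0 pF) mul0r steinberg0.
have nZQ : Q0 \subset 'N(Z).
  rewrite gen_subG; apply/subsetP=> g gQ; rewrite inE.
  rewrite -genJ gen_subG; apply/subsetP=> _ /imsetP[h hZ ->].
  have jg : (h ^ g = h * [~ h, g])%g by rewrite conjg_mulR.
  move: gQ; rewrite !inE => /orP[]/eqP->; move: h hZ {jg}; apply: (ZAP _) => a.
  - rewrite conjgE (_ : x i l a * x i j 1%R = x i j 1%R * x i l a)%g ?mulKg //.
    by apply: (steinberg_commute stx); rewrite // eq_sym.
  - by rewrite conjg_mulR groupM // -invgR groupV (steinberg_commg stx).
  - by rewrite conjg_mulR groupM // -invgR groupV (steinberg_commg stx).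
  rewrite conjgE (_ : x j l a * x j i 1%R = x j i 1%R * x j l a)%g ?mulKg //.
  by apply: (steinberg_commute stx); rewrite // eq_sym.
have pQ : p.-group (Q0 / N)%g.
  apply: quotient_p'elts_pgroup => [|y Qy]; last by apply: p'N; apply: (subsetP sQ0).
  exact: subset_trans sQ0 (subset_trans sQH nNHs).
pose P := (Q0 <*> Z)%G.
have pP : p.-group (P / N)%g.
  have -> : P :=: (Q0 * Z)%g by exact: norm_joinEl.
  rewrite quotientMl; last exact: subset_trans sQ0 (subset_trans sQH nNHs).
  by rewrite pgroupM pQ quotient_pgroup.
have sZR : Z \subset [~: Z, Q0].
  have Qi : x i j 1 \in Q0 by rewrite mem_gen // !inE eqxx.
  have Qj : x j i 1 \in Q0 by rewrite mem_gen // !inE eqxx orbT.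
  rewrite gen_subG; apply/subsetP; apply: (ZAP _) => a; rewrite -(mul1r a).
    by rewrite -(steinberg_commg stx 1 a ij jl il) /= commGC mem_commg.
  by rewrite -(steinberg_commg stx 1 a ji il jl) /= commGC mem_commg.
have := pgroup_nil pP; rewrite /nilpotent => /forallP/(_ (Z / N)%G) /implyP h.
have nNZ := subset_trans sZH nNHs; have nNQ := subset_trans sQ0 (subset_trans sQH nNHs).
have: (Z / N)%G :==: 1%g.
  apply: h; rewrite subsetI quotientS ?joing_subr //=.
  rewrite -quotientR //; last by rewrite join_subG nNQ nNZ.
  by apply: quotientS; apply: subset_trans sZR (commgS _ (joing_subl _ _)).
rewrite /= -subG1 quotient_sub1 // => /subsetP sZN a; exact: sZN.
Qed.

Lemma ex_third_lt m (i j : 'I_n) : (2 < m)%N -> (m <= n)%N ->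
    (i < m)%N -> (j < m)%N ->
  exists l : 'I_n, [&& (l < m)%N, l != i & l != j].
Proof.
move=> m2 mn im jm; have [l lij] := ex_third (Ordinal im) (Ordinal jm) m2.
by exists (widen_ord mn l); rewrite /= ltn_ord -!(inj_eq val_inj) /= in lij *.
Qed.

Lemma normal_commgl (H N : {group gT}) g h :
  N <| H -> g \in N -> h \in H -> [~ g, h] \in N.
Proof.
by move=> /andP[_ nNH] Ng Hh; rewrite commgEl groupM ?groupV // memJ_norm // (subsetP nNH).
Qed.

Lemma normal_commgr (H N : {group gT}) g h :
  N <| H -> g \in H -> h \in N -> [~ g, h] \in N.
Proof.
by move=> nNH Hg Nh; rewrite -invgR groupV (normal_commgl nNH).
Qed.

(** Commutators with x_il(1) give the other roots of row i, then commutators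
    with these give the others. *)
Lemma one_root_trivial (H N : {group gT}) m (i l : 'I_n) :
    (2 < m)%N -> (m <= n)%N -> N <| H -> root_group m \subset H ->
    (i < m)%N -> (l < m)%N -> i != l -> x i l 1 \in N ->
  root_group m \subset N.
Proof.
move=> m2 mn nNH sH im lm il Nil.
have xH (u v : 'I_n) a : (u < m)%N -> (v < m)%N -> u != v -> x u v a \in H.
  by move=> um vm uv; apply: (subsetP sH); apply: mem_root_group.
pose T (u v : 'I_n) := forall a, x u v a \in N.
have Tr (u v w : 'I_n) : (u < m)%N -> (v < m)%N -> (w < m)%N ->
    u != v -> v != w -> u != w -> T u v -> T u w.
  move=> um vm wm uv vw uw Tuv a; rewrite -(mul1r a) -(steinberg_commg stx 1 a uv vw uw).
  by rewrite (normal_commgl nNH) // xH.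
have Tl (u v w : 'I_n) : (u < m)%N -> (v < m)%N -> (w < m)%N ->
    u != v -> v != w -> u != w -> T v w -> T u w.
  move=> um vm wm uv vw uw Tvw a; rewrite -(mul1r a) -(steinberg_commg stx 1 a uv vw uw).
  by rewrite (normal_commgr nNH) // xH.
have T1 (v : 'I_n) : (v < m)%N -> v != i -> v != l -> T i v.
  move=> vm vi vl a; have lv : l != v by rewrite eq_sym.
  have iv : i != v by rewrite eq_sym.
  rewrite -(mul1r a) -(steinberg_commg stx 1 a il lv iv).
  by rewrite (normal_commgl nNH) // xH.
have Ti (v : 'I_n) : (v < m)%N -> v != i -> T i v.
  move=> vm vi; have [->{v vm vi}|vl] := eqVneq v l; last exact: T1.
  have [w /and3P[wm wi wl]] := ex_third_lt m2 mn im lm.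
  by apply: (Tr i w l) => //; [rewrite eq_sym | apply: T1].
have Tn (u v : 'I_n) : (u < m)%N -> (v < m)%N -> u != i -> v != i -> u != v -> T u v.
  by move=> um vm ui vi uv; apply: (Tl u i v) => //; [rewrite eq_sym | apply: Ti].
apply: root_group_subP => u v a um vm uv; move: a; rewrite -/(T u v).
have [ui|ui] := eqVneq u i; first by subst u; apply: Ti; rewrite // eq_sym.
have [vi|vi] := eqVneq v i; last exact: Tn.
have [w /and3P[wm wu wv]] := ex_third_lt m2 mn um vm.
have uw : u != w by rewrite eq_sym.
by apply: (Tr u w v) => //; apply: Tn; rewrite // -vi.
Qed.

Variable k : fieldType.
Hypothesis pk : p \in [pchar k].

(** Nontriviality of a p'-element, unlike that of the group itself, passes from
    a module to a submodule or to the quotient by it, see [p'elt_rker_ext]. *)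
Definition acts_nontrivially m (H : {group gT}) d
    (rH : mx_representation k H d) : bool :=
  [exists y in root_group m, p^'.-elt y && (y \notin rker rH)].

(** As the p'-elements of the smaller group lie in the kernel,
    [p'free_root_trivial] puts one root of the larger group into it, and
    [one_root_trivial] the others. *)
Lemma root_group_trivial m (H : {group gT}) d
    (rH : mx_representation k H d) :
    (1 < m)%N -> (m < n)%N -> root_group m.+1 \subset H ->
  ~~ acts_nontrivially m rH -> root_group m.+1 \subset rker rH.
Proof.
move=> m1 mn sH /existsP nact.
have n0 : (0 < n)%N by apply: leq_ltn_trans mn.
have i0m : (0 < m)%N by apply: ltnW.
pose i0 := Ordinal n0; pose i1 := Ordinal (ltn_trans m1 mn); pose i2 := Ordinal mn.
have i01 : i0 != i1 by [].
have i12 : i1 != i2 by rewrite -val_eqE /= ltn_eqF.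
have i02 : i0 != i2 by rewrite -val_eqE /= ltn_eqF.
have sub : root_group m \subset H.
  apply: subset_trans sH; apply: root_group_subP => u v a um vm uv.
  by apply: mem_root_group; rewrite // ltnS ltnW.
have xH (u v : 'I_n) a : (u < m.+1)%N -> (v < m.+1)%N -> u != v -> x u v a \in H.
  by move=> um vm uv; apply: (subsetP sH); apply: mem_root_group.
apply: (@one_root_trivial H _ m.+1 i0 i2) => //=.
  exact: rker_normal.
apply: (@p'free_root_trivial H _ (root_group m) i0 i1 i2) => //.
- exact: rker_normal.
- by apply: mem_root_group.
- by apply: mem_root_group; rewrite // eq_sym.
- by move=> a; apply: xH; rewrite //= ltnS ltnW.
- by move=> a; apply: xH; rewrite //= ltnS ltnW.
move=> y Qy p'y; apply: contraPT (nact) => Ny; case; exists y.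
by rewrite Qy p'y Ny.
Qed.

End LowerBound.

(** The columns of M lie in the kernel of C on column vectors, which is a line. *)
Lemma rank1_common_col (k : fieldType) d (C : 'M[k]_d) : (\rank C).+1 = d ->
  exists c : 'cV[k]_d, forall M : 'M[k]_d, C *m M = 0 ->
  exists r : 'rV[k]_d, M = c *m r.
Proof.
move=> rC; have rK : \rank (kermx C^T) = 1%N by rewrite mxrank_ker mxrank_tr -{1}rC subSnn.
pose v := castmx (rK, erefl d) (row_base (kermx C^T)).
exists v^T => M CM.
have /submxP[w ew] : (M^T <= v)%MS.
  rewrite eqmx_cast eq_row_base; apply/sub_kermxP.
  by rewrite -trmx_mul CM trmx0.
by exists w^T; rewrite -trmx_mul -ew trmxK.
Qed.

Section LowerBoundStep.

Variables (F : finFieldType) (p : nat) (gT : finGroupType) (n : nat).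
Hypothesis pF : p \in [pchar F].
Variable x : 'I_n -> 'I_n -> F -> gT.
Hypothesis stx : steinberg x.
Variable k : fieldType.
Hypothesis pk : p \in [pchar k].

Definition common_col (H : {group gT}) d (rH : mx_representation k H d) m (i : 'I_n) :=
  exists c : 'cV[k]_d, forall (j : 'I_n) a, (j < m)%N -> i != j ->
  exists r : 'rV[k]_d, rH (x i j a) = 1%:M + c *m r.

Definition common_row (H : {group gT}) d (rH : mx_representation k H d) m (i : 'I_n) :=
  exists r : 'rV[k]_d, forall (j : 'I_n) a, (j < m)%N -> i != j ->
  exists c : 'cV[k]_d, rH (x i j a) = 1%:M + c *m r.

(** Let U be the group of the x_mj, j < m, and C its fixed space, which is stable
    under L = < x_ij : i, j < m >. It is nonzero as U is a p-group, and proper as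
    otherwise all roots would act trivially. A p'-element of L acts nontrivially
    on C or on V/C, whose degree is then at least m by induction. In degree m + 1
    one of the two is a line. If it is V/C, all x_mj(a) - 1 kill the hyperplane C
    and share their column. If it is C, then by the same argument U acts
    trivially on V/C, the rows of all x_mj(a) - 1 lie in C, and they share their
    row. *)
Lemma lower_bound_step m (mn : (m < n)%N) : (1 < m)%N ->
    (forall (H : {group gT}) d (rH : mx_representation k H d),
       root_group x m \subset H -> acts_nontrivially p x m rH -> (m <= d)%N) ->
  forall (H : {group gT}) d (rH : mx_representation k H d),
    root_group x m.+1 \subset H -> acts_nontrivially p x m.+1 rH ->
  (m < d)%N /\ (d = m.+1 ->
    common_col rH m.+1 (Ordinal mn) \/ common_row rH m.+1 (Ordinal mn)).
Proof.
move=> m1 IH H d rH sH actH; pose e := Ordinal mn.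
have sLL : root_group x m \subset root_group x m.+1.
  apply: root_group_subP => u v a um vm uv.
  by apply: mem_root_group; rewrite // ltnS ltnW.
have ej (j : 'I_n) : (j < m)%N -> e != j.
  by move=> jm; rewrite -val_eqE /= gtn_eqF.
have xH (j : 'I_n) a : (j < m)%N -> x e j a \in H.
  move=> jm; apply: (subsetP sH); apply: mem_root_group => //=; first exact: ltnW.
  exact: ej.
pose UA := [set g | [exists j : 'I_n, [exists a, (j < m)%N && (g == x e j a)]]].
pose U := <<UA>>%G; pose L := root_group x m.
have UAP (P : gT -> Prop) : (forall (j : 'I_n) a, (j < m)%N -> P (x e j a)) ->
    forall g, g \in UA -> P g.
  by move=> h g; rewrite inE => /existsP[j /existsP[a /andP[jm /eqP->]]]; apply: h.
have xU (j : 'I_n) a : (j < m)%N -> x e j a \in U.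
  move=> jm; rewrite mem_gen // inE; apply/existsP; exists j; apply/existsP; exists a.
  by rewrite jm eqxx.
have sUH : U \subset H by rewrite gen_subG; apply/subsetP; apply: (UAP _).
have abU : abelian UA.
  apply/centsP; apply: (UAP _) => i a im; apply: (UAP _) => j b jm.
  by apply: (steinberg_commute stx); rewrite ?ej // eq_sym ej.
have pU : p.-group U.
  rewrite -pnat_exponent /= (abelian_exponent_gen abU).
  apply: (@pnat_dvd _ (p ^ 1)); last exact: pnat_id (pcharf_prime pF).
  apply/exponentP; apply: (UAP _) => j a jm.
  by rewrite -steinbergMn ?ej // -mulr_natl (pcharf0 pF) mul0r steinberg0 ?ej.
have nUL : L \subset 'N(U).
  apply: root_group_subP => i j a im jm ij; rewrite inE -genJ gen_subG.
  apply/subsetP=> _ /imsetP[g gU ->]; move: g gU; apply: (UAP _) => l b lm.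
  have [->|li] := eqVneq l i.
    by rewrite conjg_mulR groupM ?xU // (steinberg_commg stx) ?ej // xU.
  rewrite conjgE (_ : x e l b * x i j a = x i j a * x e l b)%g ?mulKg ?xU //.
  by apply: (steinberg_commute stx); rewrite ?ej.
have sLH : L \subset H by apply: subset_trans sH.
pose K := (L <*> U)%G.
have sKH : K \subset H by rewrite join_subG sLH.
have sLK : L \subset K by apply: joing_subl.
have sUK : U \subset K by apply: joing_subr.
have nUK : U <| K by rewrite /normal sUK join_subG nUL normG.
pose rK := subg_repr rH sKH.
have nactL : root_group x m.+1 \subset rker rH -> False.
  move=> /subsetP trivH; case/existsP: actH => y /and3P[Ly _ /negP]; apply.
  exact: trivH.
have actL : acts_nontrivially p x m rH.
  apply: contraT => nact; case: nactL.
  exact: (root_group_trivial pF stx m1 mn sH nact).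
have [y /and3P[Ly p'y Ny]] := existsP actL.
have Ky : y \in K by apply: (subsetP sLK).
have d0 : (0 < d)%N by apply: leq_trans (IH _ _ _ sLH actL); apply: ltnW.
have Utriv : U \subset rker rH -> False.
  move=> /subsetP trivU; apply: nactL.
  have m0 : (0 < m)%N by apply: ltnW.
  pose i0 : 'I_n := Ordinal (ltn_trans m0 mn).
  apply: (@one_root_trivial _ _ _ _ stx H _ m.+1 e i0) => //.
  - exact: rker_normal.
  - by apply: ej.
  by apply: trivU; apply: xU.
pose C := rfix_mx rK U; have Cmod : mxmodule rK C by apply: normal_rfix_mx_module.
have C0 : C != 0 by apply: (rfix_pgroup_pchar pk).
have Ufix d' (r : mx_representation k K d') : \rank (rfix_mx r U) = d' -> U \subset rker r.
  move=> rU; apply/subsetP=> u Uu; apply/rkerP; split; first exact: (subsetP sUK).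
  have /rfix_mxP h : (1%:M <= rfix_mx r U)%MS by rewrite sub1mx /row_full rU.
  by rewrite -[LHS]mul1mx h.
have rC : (0 < \rank C < d)%N.
  rewrite lt0n mxrank_eq0 C0 /= ltn_neqAle rank_leq_row andbT.
  apply/eqP=> rCd; apply: Utriv; apply: subset_trans (Ufix _ _ rCd) _.
  by rewrite rker_subg subsetIr.
have split_act d' (r : mx_representation k K d') (W : 'M_d') (Wmod : mxmodule r W) :
    y \notin rker r -> (m <= \rank W)%N \/ (m <= d' - \rank W)%N.
  move=> Ny'; have [ysub|ysub] := boolP (y \in rker (submod_repr Wmod)).
    right; rewrite -mxrank_coker; apply: (IH K _ (factmod_repr Wmod)) => //.
    apply/existsP; exists y; rewrite Ly p'y /=; apply: contra Ny'.
    exact: (p'elt_rker_ext pk Ky p'y ysub).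
  left; apply: (IH K _ (submod_repr Wmod)) => //.
  by apply/existsP; exists y; rewrite Ly p'y.
have NyK : y \notin rker rK by rewrite rker_subg inE Ky.
have [mC mC'] := andP rC.
have mCC : (m <= \rank C)%N \/ (m <= d - \rank C)%N := split_act _ _ _ Cmod NyK.
split.
  by case: mCC => mr; [apply: leq_ltn_trans mC' | rewrite (leq_ltn_trans mr) // ltn_subrL mC].
move=> dm; have jm (j : 'I_n) : (j < m.+1)%N -> e != j -> (j < m)%N.
  by rewrite ltnS leq_eqVlt -val_eqE /= => /orP[/eqP->|//]; rewrite eqxx.
have [rCm|rC1] : \rank C = m \/ \rank C = 1%N.
  move: mC mC' mCC; move: (\rank C) => r; rewrite dm; clear -m1 => r0 r1 [mr|mr].
    by left; lia.
  by right; lia.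
  left; have [c cP] : exists c : 'cV[k]_d, forall M : 'M[k]_d, C *m M = 0 ->
      exists r : 'rV[k]_d, M = c *m r by apply: rank1_common_col; rewrite rCm dm.
  exists c => j a jm1 ejn; have [|r rE] := cP (rH (x e j a) - 1%:M).
    by rewrite mulmxBr mulmx1 (rfix_mx_id rK (xU _ _ (jm _ jm1 ejn))) subrr.
  by exists r; rewrite -rE addrC subrK.
right; pose rQ := factmod_repr Cmod.
have NyQ : y \notin rker rQ.
  have ysub : y \in rker (submod_repr Cmod).
    apply: contraT => ysub; have: (m <= \rank C)%N.
      by apply: (IH K _ (submod_repr Cmod)) => //; apply/existsP; exists y; rewrite Ly p'y.
    by rewrite rC1 leqNgt m1.
  by apply: contra NyK; exact: (p'elt_rker_ext pk Ky p'y ysub).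
have dQ : \rank (cokermx C) = m by rewrite mxrank_coker rC1 dm subSS subn0.
have Q0 : rfix_mx rQ U != 0 by apply: (rfix_pgroup_pchar pk); rewrite // dQ ltnW.
have UQ : U \subset rker rQ.
  apply: Ufix; have Qmod : mxmodule rQ (rfix_mx rQ U) by apply: normal_rfix_mx_module.
  rewrite -mxrank_eq0 -lt0n in Q0; apply/eqP; rewrite eqn_leq rank_leq_row /=.
  have [rm|rm] := split_act _ _ _ Qmod NyQ; first by apply: leq_trans rm; rewrite dQ.
  have : (m < \rank (cokermx C))%N.
    by apply: leq_ltn_trans rm _; rewrite ltn_subrL Q0 dQ ltnW.
  by rewrite {1}dQ ltnn.
exists (castmx (rC1, erefl d) (row_base C)) => j a jm1 ejn.
have xu := xU _ a (jm _ jm1 ejn).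
have := subsetP UQ _ xu; rewrite rker_factmodP ?(subsetP sUK) //= => sub.
have /submxP[c cE] : (rH (x e j a) - 1%:M <= castmx (rC1, erefl d) (row_base C))%MS.
  by rewrite eqmx_cast eq_row_base.
by exists c; rewrite -cE addrC subrK.
Qed.

(** The induction starts at m = 2: in degree one, elements of order p act
    trivially in characteristic p. *)
Lemma root_group_lower_bound m : (1 < m)%N -> (m <= n)%N ->
  forall (H : {group gT}) d (rH : mx_representation k H d),
    root_group x m \subset H -> acts_nontrivially p x m rH -> (m <= d)%N.
Proof.
elim: m => // m IH m1 mn H d rH sH act; move: m1; rewrite ltnS leq_eqVlt => /orP[/eqP m1|m1].
  subst m; rewrite ltnNge; apply/negP=> d1; have [y /and3P[Ly _ /negP]] := existsP act; apply.
  apply: (subsetP _ _ Ly); apply: root_group_subP => i j a im jm ij.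
  have Hx : x i j a \in H by apply: (subsetP sH); apply: mem_root_group.
  apply/rkerP; split=> //; case: d rH d1 {act} => [|[|d]] // rH _.
    by rewrite [LHS]flatmx0 [RHS]flatmx0.
  set g := x i j a in Hx *; set c := rH g 0 0.
  have gX m : rH (g ^+ m)%g = (c ^+ m)%:M.
    elim: m => [|m IHm]; first by rewrite repr_mx1.
    by rewrite expgS repr_mxM ?groupX // IHm [rH g]mx11_scalar -scalar_mxM exprS.
  have : (c ^+ p)%:M = 1%:M :> 'M_1.
    rewrite -gX -(steinbergMn stx) // -mulr_natl (pcharf0 pF) mul0r.
    by rewrite (steinberg0 stx) // repr_mx1.
  move/(congr1 (fun A : 'M_1 => A 0 0)); rewrite !mxE !eqxx !mulr1n => cp.
  rewrite [LHS]mx11_scalar -/c; congr (_%:M); apply/eqP; rewrite -subr_eq0.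
  have := pFrobenius_autB_comm pk (mulrC c 1); rewrite !pFrobenius_autE cp expr1n subrr.
  by move/eqP; rewrite expf_eq0 => /andP[].
by have [] := lower_bound_step mn m1 (IH m1 (ltnW mn)) sH act.
Qed.

End LowerBoundStep.

(** * Recognition of the natural module *)

Lemma rmorphism_of (R S : nzRingType) (f : R -> S) :
    (forall a b, f (a + b) = f a + f b) -> (forall a b, f (a * b) = f a * f b) ->
    f 1 = 1 ->
  exists s : {rmorphism R -> S}, forall a, s a = f a.
Proof.
move=> fD fM f1; have f0 : f 0 = 0 by apply: (addrI (f 0)); rewrite -fD !addr0.
have fB : {morph f : a b / a - b}.
  move=> a b; rewrite fD; congr (_ + _).
  by apply: (addrI (f b)); rewrite -fD !subrr f0.
have fMm : monoid_morphism f by split.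
pose m1 := GRing.isZmodMorphism.Build R S f fB.
pose m2 := GRing.isMonoidMorphism.Build R S f fMm.
pose s : {rmorphism R -> S} := HB.pack f m1 m2.
by exists s.
Qed.

Lemma rank1_col_prop (k : fieldType) n (c c' : 'cV[k]_n) (r r' : 'rV[k]_n) :
  c *m r = c' *m r' -> c *m r != 0 -> exists2 t, t != 0 & c' = t *: c.
Proof.
move=> e N0; have [u [v Nuv]] : exists u v, (c *m r) u v != 0.
  case: (pickP (fun uv : 'I_n * 'I_n => (c *m r) uv.1 uv.2 != 0)) => [[u v]|no].
    by exists u, v.
  by case/eqP: N0; apply/matrixP=> u v; move: (no (u, v)) => /negbFE/eqP /= ->; rewrite mxE.
have E a b : c a 0 * r 0 b = c' a 0 * r' 0 b.
  by have := congr1 (fun A : 'M_n => A a b) e; rewrite !mxE !big_ord1.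
move: Nuv; rewrite mxE big_ord1 => Nuv.
have r'v : r' 0 v != 0.
  by apply: contraNneq Nuv => z; rewrite E z mulr0.
have rv : r 0 v != 0 by apply: contraNneq Nuv => ->; rewrite mulr0.
exists (r 0 v / r' 0 v); first by rewrite mulf_neq0 ?invr_neq0.
apply/matrixP=> a b; rewrite ord1 mxE; apply: (mulIf r'v).
by rewrite -E mulrAC divfK // mulrC.
Qed.

Lemma rank1_row_prop (k : fieldType) n (c c' : 'cV[k]_n) (r r' : 'rV[k]_n) :
  c *m r = c' *m r' -> c *m r != 0 -> exists2 t, t != 0 & r' = t *: r.
Proof.
move=> e N0; have [| |t t0 rt] := @rank1_col_prop _ _ r^T r'^T c^T c'^T.
- by rewrite -!trmx_mul e.
- by rewrite -trmx_mul -(inj_eq trmx_inj) trmxK trmx0.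
by exists t => //; apply: trmx_inj; rewrite rt linearZ.
Qed.

Section Classification.

Variables (F : finFieldType) (p : nat) (gT : finGroupType) (n : nat).
Hypotheses (pF : p \in [pchar F]) (n_gt2 : (2 < n)%N).
Variables (k : fieldType) (H : {group gT}) (rH : mx_representation k H n).
Hypothesis pk : p \in [pchar k].

Definition root_system_in (x : 'I_n -> 'I_n -> F -> gT) :=
  [/\ steinberg x, (forall i j a, i != j -> x i j a \in H)
    & (forall i j a, i != j -> a != 0 -> rH (x i j a) != 1%:M)].

Definition row_col (x : 'I_n -> 'I_n -> F -> gT) i :=
  exists c : 'cV[k]_n, forall j (a : F), i != j ->
  exists r : 'rV[k]_n, rH (x i j a) = 1%:M + c *m r.

Definition row_row (x : 'I_n -> 'I_n -> F -> gT) i :=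
  exists r : 'rV[k]_n, forall j (a : F), i != j ->
  exists c : 'cV[k]_n, rH (x i j a) = 1%:M + c *m r.

(** The family x precomposed with the inverse transpose automorphism of SL_n(F);
    its rows are the columns of x. *)
Definition transpose_roots (x : 'I_n -> 'I_n -> F -> gT) i j a := x j i (- a).

Lemma transpose_roots_in x : root_system_in x -> root_system_in (transpose_roots x).
Proof.
case=> stx xH x1; rewrite /transpose_roots; split=> [|i j a ij|i j a ij a0].
- split=> [i j a b ij|i j l m a b ij lm jl im|i j l a b ij jl il].
  + by rewrite opprD (steinbergD stx) // eq_sym.
  + by apply: (steinberg_commute stx); rewrite // eq_sym.
  rewrite -invgR (steinberg_commg stx) 1?eq_sym //.
  by rewrite -(steinbergN stx) 1?eq_sym // mulrNN mulrC.
- by apply: xH; rewrite eq_sym.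
by apply: x1; rewrite ?oppr_eq0 // eq_sym.
Qed.

(** [lower_bound_step] describes the last row; the other rows are reached by a
    relabelling of the indices. *)
Lemma row_type x i : root_system_in x -> row_col x i \/ row_row x i.
Proof.
case=> stx xH x1.
have n0 : (0 < n)%N by apply: leq_trans n_gt2.
have n1 : (n.-1 < n)%N by rewrite prednK.
pose e := Ordinal n1; pose t := tperm i e.
pose y u v a := x (t u) (t v) a.
have sty : steinberg y.
  split=> [u v a b uv|u v w z a b uv wz vw uz|u v w a b uv vw uw]; rewrite /y.
  - by rewrite (steinbergD stx) // (inj_eq perm_inj).
  - by apply: (steinberg_commute stx); rewrite (inj_eq perm_inj).
  by rewrite (steinberg_commg stx) // (inj_eq perm_inj).
have n2 : (1 < n.-1)%N by rewrite -subn1 ltn_subRL.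
have sub m : root_group y m \subset H.
  by apply: root_group_subP => u v a _ _ uv; apply: xH; rewrite (inj_eq perm_inj).
have act : acts_nontrivially p y n.-1.+1 rH.
  apply: contraT => nact; have nact' : ~~ acts_nontrivially p y n.-1 rH.
    apply: contra nact => /existsP[g /andP[gy gP]]; apply/existsP; exists g.
    rewrite gP andbT; apply: (subsetP _ _ gy).
    apply: root_group_subP => u v a um vm uv.
    by apply: mem_root_group; rewrite // ltnW.
  have [j /andP[ji _]] := ex_third i i n_gt2.
  have := root_group_trivial pF sty n2 n1 (sub _) nact'.
  move/subsetP/(_ (y (t i) (t j) 1)); case/(_ _)/rkerP.
    by apply: mem_root_group; rewrite ?prednK // (inj_eq perm_inj) eq_sym.
  rewrite /y !tpermK => _ /eqP; apply: contraLR => _.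
  by apply: x1; rewrite ?oner_eq0 // eq_sym.
have IH := root_group_lower_bound pF sty pk n2 (ltnW n1).
have [_ /(_ (esym (prednK n0)))] := lower_bound_step pF sty pk n1 n2 IH (sub _) act.
have tj j : i != j -> e != t j by rewrite -(inj_eq (@perm_inj _ t)) tpermL; apply.
by case=> -[v vP]; [left | right]; exists v => j a ij;
  have [|w wE] := vP (t j) a _ (tj j ij); rewrite ?prednK //;
  exists w; rewrite -wE /y tpermK tpermR.
Qed.

(** The column c is an eigenvector of g for the eigenvalue 1 + r c, which is a
    p-th root of unity, hence 1. *)
Lemma rank1_pelt g (c : 'cV[k]_n) (r : 'rV[k]_n) : g \in H -> (g ^+ p = 1)%g ->
  rH g = 1%:M + c *m r -> r *m c = 0.
Proof.
move=> Hg gp rg; have [->|c0] := eqVneq c 0; first by rewrite mulmx0.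
pose m := (r *m c) 0 0; have rc : r *m c = m%:M by rewrite -mx11_scalar.
have gX j : rH (g ^+ j)%g *m c = (1 + m) ^+ j *: c.
  elim: j => [|j IH]; first by rewrite repr_mx1 mul1mx scale1r.
  rewrite expgS repr_mxM ?groupX // -mulmxA IH -scalemxAr rg mulmxDl mul1mx.
  rewrite -mulmxA rc mul_mx_scalar -{1}(scale1r c) -scalerDl scalerA.
  by rewrite exprSr.
have /eqP : (1 + m) ^+ p *: c = 1 *: c by rewrite -gX gp repr_mx1 mul1mx scale1r.
rewrite -subr_eq0 -scalerBl scaler_eq0 (negbTE c0) orbF.
have := pFrobenius_autD_comm pk (mulrC 1 m); rewrite !pFrobenius_autE expr1n => ->.
by rewrite addrC addKr expf_eq0 => /andP[_ /eqP m0]; rewrite rc m0 raddf0.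
Qed.

Lemma noncommuting_roots x i l j : root_system_in x -> i != l -> l != j -> i != j ->
  rH (x i l 1) *m rH (x l j 1) <> rH (x l j 1) *m rH (x i l 1).
Proof.
case=> stx xH x1 il lj ij comm.
have := x1 i j (1 * 1) ij; rewrite mulr1 oner_eq0 => /(_ isT)/eqP; apply.
rewrite -[X in x i j X](mulr1 1) -(steinberg_commg stx 1 1 il lj ij).
have Hil := xH i l 1 il; have Hlj := xH l j 1 lj.
have /(congr1 rH) := commgC (x i l 1) (x l j 1).
have Hc : [~ x i l 1, x l j 1] \in H by rewrite groupR.
rewrite (repr_mxM rH (groupM Hlj Hil) Hc) !(repr_mxM rH Hil Hlj) comm.
rewrite (repr_mxM rH Hlj Hil) => e; have u : rH (x l j 1) *m rH (x i l 1) \in unitmx.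
  by rewrite -repr_mxM // repr_mx_unit ?groupM.
by rewrite -[LHS](mulKmx u) -e mulVmx.
Qed.

Lemma steinberg_expg_p (x : 'I_n -> 'I_n -> F -> gT) i j a :
  steinberg x -> i != j -> (x i j a ^+ p = 1 :> gT)%g.
Proof.
move=> stx ij; rewrite -(steinbergMn stx) // -mulr_natl (pcharf0 pF) mul0r.
by rewrite (steinberg0 stx).
Qed.

(** If row i and column j of the system both had a common column vector, the two
    vectors would be proportional because of x_ij. Then x_il and x_lj would
    have proportional columns, each killed by both rows, and would commute. *)
Lemma row_col_clash x i j : root_system_in x -> i != j ->
  row_col x i -> row_col (transpose_roots x) j -> False.
Proof.
move=> xR ij [c cP] [c' cP']; have [stx xH x1] := xR; have ji : j != i by rewrite eq_sym.
have [l /andP[li lj]] := ex_third i j n_gt2; have il : i != l by rewrite eq_sym.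
have jl : j != l by rewrite eq_sym.
have [r rE] := cP j 1 ij; have [r' rE'] := cP' i (-1) ji.
have [r1 rE1] := cP l 1 il; have [r2 rE2] := cP' l (-1) jl.
rewrite /transpose_roots opprK in rE' rE2.
have N0 : c *m r != 0.
  by have := x1 i j 1 ij (oner_neq0 _); rewrite rE -subr_eq0 addrAC subrr add0r.
have [|t t0 ct] := rank1_col_prop (_ : c *m r = c' *m r') N0.
  by apply: (addrI 1%:M); rewrite -rE.
have r1c := rank1_pelt (xH i l 1 il) (steinberg_expg_p 1 stx il) rE1.
have r2c := rank1_pelt (xH l j 1 lj) (steinberg_expg_p 1 stx lj) rE2.
have r1c' : r1 *m c' = 0 by rewrite ct -scalemxAr r1c scaler0.
have r2c' : r2 *m c = 0.
  by apply: (scalerI t0); rewrite scalemxAr -ct r2c scaler0.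
apply: (noncommuting_roots xR il lj ij); rewrite rE1 rE2.
rewrite !mulmxDl !mul1mx !mulmxDr !mulmx1 -!mulmxA (mulmxA r1) (mulmxA r2) r1c' r2c'.
by rewrite !mul0mx !mulmx0 !addr0 -!addrA; congr (_ + _); rewrite addrC.
Qed.

(** As in [row_col_clash], with common row vectors. *)
Lemma row_row_clash x i j : root_system_in x -> i != j ->
  row_row x i -> row_row (transpose_roots x) j -> False.
Proof.
move=> xR ij [r rP] [r' rP']; have [stx xH x1] := xR; have ji : j != i by rewrite eq_sym.
have [l /andP[li lj]] := ex_third i j n_gt2; have il : i != l by rewrite eq_sym.
have jl : j != l by rewrite eq_sym.
have [c cE] := rP j 1 ij; have [c' cE'] := rP' i (-1) ji.
have [c1 cE1] := rP l 1 il; have [c2 cE2] := rP' l (-1) jl.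
rewrite /transpose_roots opprK in cE' cE2.
have N0 : c *m r != 0.
  by have := x1 i j 1 ij (oner_neq0 _); rewrite cE -subr_eq0 addrAC subrr add0r.
have [|t t0 rt] := rank1_row_prop (_ : c *m r = c' *m r') N0.
  by apply: (addrI 1%:M); rewrite -cE.
have r1c := rank1_pelt (xH i l 1 il) (steinberg_expg_p 1 stx il) cE1.
have r2c := rank1_pelt (xH l j 1 lj) (steinberg_expg_p 1 stx lj) cE2.
have r1c' : r' *m c1 = 0 by rewrite rt -scalemxAl r1c scaler0.
have r2c' : r *m c2 = 0.
  by apply: (scalerI t0); rewrite scalemxAl -rt r2c scaler0.
apply: (noncommuting_roots xR il lj ij); rewrite cE1 cE2.
rewrite !mulmxDl !mul1mx !mulmxDr !mulmx1 -!mulmxA (mulmxA r) (mulmxA r') r1c' r2c'.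
by rewrite !mul0mx !mulmx0 !addr0 -!addrA; congr (_ + _); rewrite addrC.
Qed.

(** The clashes say that row i and column j are of opposite types for i and j
    different, and with three indices all rows then have the same type. *)
Lemma uniform_type x : root_system_in x ->
  (forall i, row_col x i /\ row_row (transpose_roots x) i) \/
  (forall i, row_col (transpose_roots x) i /\ row_row x i).
Proof.
move=> xR; have xtR := transpose_roots_in xR.
pose o := Ordinal (ltnW (ltnW n_gt2)).
have third i j : exists2 l : 'I_n, l != i & l != j.
  by have [l /andP[]] := ex_third i j n_gt2; exists l.
case: (row_type o xR) => [oc|or]; [left | right].
  have colr j : j != o -> row_row (transpose_roots x) j.
    move=> jo; case: (row_type j xtR) => // jc.
    by case: (@row_col_clash x o j); rewrite // eq_sym.
  have rowc i : row_col x i.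
    case: (row_type i xR) => // ir; have [j jo ji] := third o i.
    by case: (@row_row_clash x i j); rewrite // 1?eq_sym //; apply: colr.
  move=> i; split=> //; case: (row_type i xtR) => // ic; have [j ji _] := third i i.
  by case: (@row_col_clash x j i).
have colc j : j != o -> row_col (transpose_roots x) j.
  move=> jo; case: (row_type j xtR) => // jr.
  by case: (@row_row_clash x o j); rewrite // eq_sym.
have rowr i : row_row x i.
  case: (row_type i xR) => // ic; have [j jo ji] := third o i.
  by case: (@row_col_clash x i j); rewrite // 1?eq_sym //; apply: colc.
move=> i; split=> //; case: (row_type i xtR) => // ir; have [j ji _] := third i i.
by case: (@row_row_clash x j i).
Qed.

(** Here x_ij(a) = 1 + t_ij(a) c_i r_j. Since root elements have order p,
    r_j c_i = 0 for i and j different, and m_j = r_j c_j is not zero since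
    otherwise all commutators would vanish. The relations say that
    t_ij is additive and t_il(ab) = t_ij(a) t_jl(b) m_j. Rescaling the c_i
    gives t_ij(a) m_j the common value s(a), a ring morphism. The r_j, rescaled,
    are the rows of P, and the c_i are the columns of its inverse. *)
Lemma elementary_form x : root_system_in x ->
    (forall i, row_col x i /\ row_row (transpose_roots x) i) ->
  exists (s : {rmorphism F -> k}) (P : 'M[k]_n), P \in unitmx /\
    forall i j a, i != j -> P *m rH (x i j a) = transv i j (s a) *m P.
Proof.
move=> xR xT; have [stx xH x1] := xR.
have [c cP] := fin_all_exists (fun i => proj1 (xT i)).
have [r rP] := fin_all_exists (fun i => proj2 (xT i)).
have NE i j a : i != j -> exists t, rH (x i j a) = 1%:M + t *: (c i *m r j).
  move=> ij; have [r' rE] := cP i j a ij; have ji : j != i by rewrite eq_sym.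
  have [c'] := rP j i (- a) ji; rewrite /transpose_roots opprK => cE.
  have [N0|N0] := eqVneq (c' *m r j) 0.
    by exists 0; rewrite scale0r cE N0.
  have eN : c' *m r j = c i *m r' by apply: (addrI 1%:M); rewrite -rE.
  have [t tn0 ct] := rank1_col_prop eN N0; exists t^-1.
  by rewrite ct -scalemxAl scalerA mulVf // scale1r.
have NE' (ija : 'I_n * 'I_n * F) : exists t, ija.1.1 != ija.1.2 ->
    rH (x ija.1.1 ija.1.2 ija.2) = 1%:M + t *: (c ija.1.1 *m r ija.1.2).
  case: ija => [[i j] a] /=; have [->|/(NE _ _ a)[t tE]] := eqVneq i j; first by exists 0.
  by exists t.
have [t0 t0E] := fin_all_exists NE'; pose t i j a := t0 (i, j, a).
have tE i j a : i != j -> rH (x i j a) = 1%:M + t i j a *: (c i *m r j) := t0E (i, j, a).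
have cr0 i j : i != j -> c i *m r j != 0.
  move=> ij; have := x1 i j 1 ij (oner_neq0 _); rewrite tE //; apply: contraNneq => ->.
  by rewrite scaler0 addr0.
have t1 i j : i != j -> t i j 1 != 0.
  move=> ij; have := x1 i j 1 ij (oner_neq0 _); rewrite tE //; apply: contraNneq => ->.
  by rewrite scale0r addr0.
pose m i j := (r i *m c j) 0 0; have mE i j : r i *m c j = (m i j)%:M by rewrite -mx11_scalar.
have m0 i j : i != j -> m j i = 0.
  move=> ij; have := tE i j 1 ij; rewrite scalemxAr => /rank1_pelt.
  rewrite xH // steinberg_expg_p // => /(_ isT (erefl _)); rewrite -scalemxAl mE => /eqP.
  rewrite scaler_eq0 (negbTE (t1 _ _ ij)) /= => /eqP/(congr1 (fun A : 'M_1 => A 0 0)).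
  by rewrite !mxE eqxx mulr1n.
have crcr i j l u : (c i *m r j) *m (c l *m r u) = m j l *: (c i *m r u).
  by rewrite mulmxA -(mulmxA (c i)) mE mul_mx_scalar scalemxAl.
have scI (v : 'M[k]_n) a b : v != 0 -> a *: v = b *: v -> a = b.
  move=> v0 /eqP; rewrite -subr_eq0 -scalerBl scaler_eq0 (negbTE v0) orbF subr_eq0.
  by move/eqP.
have tD i j a b : i != j -> t i j (a + b) = t i j a + t i j b.
  move=> ij; have := tE i j (a + b) ij.
  rewrite (steinbergD stx) // repr_mxM ?xH // !tE // mulmxDl mul1mx mulmxDr mulmx1.
  rewrite -scalemxAl -scalemxAr crcr m0 // scale0r !scaler0 addr0 -addrA -scalerDl.
  by move/addrI/(scI _ _ _ (cr0 _ _ ij)) => <-; rewrite addrC.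
have tM i j l a b : i != j -> j != l -> i != l ->
    t i l (a * b) = t i j a * t j l b * m j j.
  move=> ij jl il; have [li lj ji] : [/\ l != i, l != j & j != i] by split; rewrite eq_sym.
  have := commgC (x i j a) (x j l b); rewrite (steinberg_commg stx) // => /(congr1 rH).
  rewrite !repr_mxM ?groupM ?xH // !tE //.
  rewrite !(mulmxDl, mulmxDr, mul1mx, mulmx1) -!(scalemxAl, scalemxAr) !crcr.
  rewrite (m0 _ _ ij) (m0 _ _ il) !(scale0r, scaler0, addr0) !scalerA.
  rewrite mul0mx !scaler0 !addr0 -!addrA => /addrI; rewrite [RHS]addrCA => /addrI/addrI.
  by move/(scI _ _ _ (cr0 _ _ il)).
have mj0 j : m j j != 0.
  have [i /andP[ij _]] := ex_third j j n_gt2; have [l /andP[li lj]] := ex_third i j n_gt2.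
  have jl : j != l by rewrite eq_sym. have il : i != l by rewrite eq_sym.
  apply: contraNneq (t1 i l il) => mj; rewrite -{1}(mulr1 1) (tM i j l) //.
  by rewrite mj mulr0.
pose o := Ordinal (ltnW (ltnW n_gt2)).
(* b rescales the columns so that the coefficients of the x_io(1) become 1 *)
pose b i := if i == o then 1 else t i o 1 * m o o.
have b0 i : b i != 0.
  by rewrite /b; have [_|io] := eqVneq i o; rewrite ?oner_eq0 ?mulf_neq0 ?t1.
pose sg i j a := t i j a * m j j * b j / b i.
have sgM i j l a a' : i != j -> j != l -> i != l -> sg i l (a * a') = sg i j a * sg j l a'.
  move=> ij jl il; rewrite /sg (tM i j l) //; have := b0 i; have := b0 j.
  by move=> bj bi; field; rewrite bi bj.
have sgD i j a a' : i != j -> sg i j (a + a') = sg i j a + sg i j a'.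
  by move=> ij; rewrite /sg tD // !mulrDl.
have sgio i : i != o -> sg i o 1 = 1.
  move=> io; rewrite /sg /b (negbTE io) eqxx mulr1 divff // mulf_neq0 ?t1 //.
have sg0 i j : i != j -> sg i j 1 != 0.
  by move=> ij; rewrite /sg !mulf_neq0 ?invr_eq0 ?t1.
have sg1 i j : i != j -> sg i j 1 = 1.
  have h u v : u != v -> v != o -> u != o -> sg u v 1 = 1.
    move=> uv vo uo; apply: (mulIf (sg0 v o vo)).
    by rewrite -(sgM u v o) // mulr1 !sgio // mulr1.
  have [->|io] := eqVneq i o => ij; last first.
    by have [->|jo] := eqVneq j o; [apply: sgio | apply: h].
  have jo : j != o by rewrite eq_sym.
  have [l /andP[lo lj]] := ex_third o j n_gt2.
  by apply: (mulfI (sg0 l o lo)); rewrite -(sgM l o j) // mulr1 sgio // h // mulr1.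
have sgr i j l a : i != j -> i != l -> sg i l a = sg i j a.
  move=> ij il; have [->//|jl] := eqVneq j l.
  by rewrite -{1}(mulr1 a) (sgM i j l) // sg1 // mulr1.
have sgc i j l a : i != l -> j != l -> sg i l a = sg j l a.
  move=> il jl; have [->//|ij] := eqVneq i j.
  by rewrite -{1}(mul1r a) (sgM i j l) // sg1 // mul1r.
have [o' /andP[o'o _]] := ex_third o o n_gt2; have oo' : o != o' by rewrite eq_sym.
have sgE i j a : i != j -> sg i j a = sg o o' a.
  have h u v : u != v -> v != o -> sg u v a = sg o o' a.
    move=> uv vo; have ov : o != v by rewrite eq_sym.
    by rewrite (sgc u o v) // (sgr o o' v).
  have [->{j}|jo] := eqVneq j o => ij; last exact: h.
  have [w /andP[wi wo]] := ex_third i o n_gt2; have iw : i != w by rewrite eq_sym.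
  by rewrite (sgr i w o) // h.
have [w /andP[wo wo']] := ex_third o o' n_gt2; have ow : o != w by rewrite eq_sym.
have [||| s sE] := @rmorphism_of _ _ (sg o o').
- by move=> a a'; apply: sgD.
- by move=> a a'; rewrite (sgM o w o') // !sgE.
- exact: sg1.
exists s; pose P := \matrix_(j, v) ((b j * m j j)^-1 * r j 0 v); exists P.
have PcE l i : (P *m c i) l 0 = (b l * m l l)^-1 * m l i.
  have mS : m l i = \sum_v r l 0 v * c i v 0 by rewrite /m mxE.
  rewrite mxE [in X in _ = _ * X]mS big_distrr /=; apply: eq_bigr => v _.
  by rewrite mxE mulrA.
split.
  suff /mulmx1_unit[] : P *m (\matrix_(v, i) (b i * c i v 0)) = 1%:M by [].
  apply/matrixP=> l i; rewrite !mxE.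
  have -> : \sum_v P l v * (\matrix_(v, i) (b i * c i v 0)) v i = b i * (P *m c i) l 0.
    by rewrite mxE big_distrr /=; apply: eq_bigr => v _; rewrite [X in _ * X]mxE mulrCA.
  rewrite PcE; have [->|li] := eqVneq l i; last first.
    by rewrite (m0 i l) ?(negbTE li) ?mulr0 // eq_sym.
  by rewrite ?eqxx invfM -mulrA (mulVf (mj0 i)) mulr1 mulfV.
move=> i j a ij; rewrite tE // mulmxDr mulmx1 -scalemxAr mulmxA.
apply/matrixP=> l v; rewrite mul_transv_mx !mx_linE sE -(sgE i j) //; congr (_ + _).
rewrite [(_ *m r j) l v]mxE big_ord1 PcE [P j v]mxE.
have [->|li] := eqVneq l i; last by rewrite (m0 i l) 1?eq_sym // !(mulr0, mul0r).
rewrite /sg mul1r; have := b0 i; have := b0 j; have := mj0 i; have := mj0 j.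
by move=> ? ? ? ?; field; apply/and4P.
Qed.

(** Replacing x by its transposed family turns the dual of the natural module
    into the natural module; both families generate the same group. *)
Lemma root_classification x : root_system_in x ->
  exists2 y, y = x \/ y = transpose_roots x
    & exists (s : {rmorphism F -> k}) (P : 'M[k]_n), P \in unitmx /\
      forall i j a, i != j -> P *m rH (y i j a) = transv i j (s a) *m P.
Proof.
move=> xR; have xtR := transpose_roots_in xR.
case: (uniform_type xR) => h; [exists x | exists (transpose_roots x)].
- by left.
- exact: elementary_form.
- by right.
apply: elementary_form => // i; split; first by have [] := h i.
have [_ [r rP]] := h i; exists r => j a ij; have [c cE] := rP j a ij.
by exists c; rewrite /transpose_roots opprK.
Qed.

End Classification.

(** * First cohomology of the natural module *)

Section NaturalModule.

Variables (k : fieldType) (gT : finGroupType) (G S : {group gT}) (n : nat).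
Variable rG : mx_representation k G n.
Hypotheses (n_gt2 : (2 < n)%N) (faithG : mx_faithful rG) (nSG : S <| G).
Variables (F : finFieldType) (s : {rmorphism F -> k}).
Variables (y : 'I_n -> 'I_n -> F -> gT) (P : 'M[k]_n).
Hypothesis Pu : P \in unitmx.
Hypothesis yS : forall i j a, i != j -> y i j a \in S.
Hypothesis yE : forall i j a, i != j -> P *m rG (y i j a) = transv i j (s a) *m P.
(** Generation of S by the root elements, as an induction principle. *)
Hypothesis S_ind : forall K : gT -> Prop, K 1%g ->
  {in S &, forall g h, K g -> K h -> K (g * h)%g} ->
  (forall i j a, i != j -> K (y i j a)) -> {in S, forall g, K g}.

(** The representation in the basis in which the root elements are elementary. *)
Let r g := P *m rG g *m invmx P.

Let sSG : S \subset G := normal_sub nSG.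
Let yG i j a : i != j -> y i j a \in G.
Proof. by move=> ij; apply: (subsetP sSG); apply: yS. Qed.

Lemma conj_reprM : {in G &, forall g h, r (g * h)%g = r g *m r h}.
Proof.
by move=> g h Gg Gh; rewrite /r repr_mxM // !mulmxA mulmxKV.
Qed.

Lemma conj_repr1 : r 1%g = 1%:M.
Proof. by rewrite /r repr_mx1 mulmx1 mulmxV. Qed.

Lemma conj_reprI : {in G &, injective r}.
Proof.
move=> g h Gg Gh /(can_inj (mulmxKV Pu)) /(can_inj (mulKmx Pu)) e.
apply/eqP; rewrite eq_mulgV1; apply/eqP/set1P; apply: (subsetP faithG).
apply/rkerP; rewrite groupM ?groupV //; split=> //.
by rewrite repr_mxM ?groupV // e -repr_mxM ?groupV // mulgV repr_mx1.
Qed.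

Lemma conj_repr_root i j a : i != j -> r (y i j a) = transv i j (s a).
Proof. by move=> ij; rewrite /r yE // mulmxK. Qed.

Lemma conj_repr_SL (A : 'M[F]_n) : \det A = 1 ->
  exists2 g, g \in S & r g = map_mx s A.
Proof.
move: A; apply: (@det1_transv_closed F n (fun A => exists2 g, g \in S & r g = map_mx s A)).
split.
- by exists 1%g; rewrite ?group1 // conj_repr1 map_mx1.
- move=> A' B [g Sg gE] [h Sh hE]; exists (g * h)%g; first exact: groupM.
  by rewrite conj_reprM ?(subsetP sSG) // gE hE map_mxM.
move=> i j a ij; exists (y i j a); first exact: yS.
by rewrite conj_repr_root // map_mxD map_mx1 map_mxZ map_delta_mx.
Qed.

Lemma conj_repr_torus z i : z != i ->
  exists2 h, h \in G & r h = diag_mx (\row_l (-1) ^+ ((l == z) || (l == i))).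
Proof.
move=> zi; pose d : 'rV[F]_n := \row_l (-1) ^+ ((l == z) || (l == i)).
have [|h Sh hE] := @conj_repr_SL (diag_mx d).
  rewrite det_diag (bigD1 z) //= (bigD1 i) 1?eq_sym //= big1 => [|l /andP[lz li]].
    by rewrite !mxE !eqxx orbT mulr1 expr1 mulrNN mulr1.
  by rewrite mxE (negbTE lz) (negbTE li).
exists h; first exact: (subsetP sSG).
rewrite hE map_diag_mx; congr diag_mx; apply/rowP=> l; rewrite !mxE.
by rewrite rmorphXn rmorphN1.
Qed.

(** A diagonal entry off i and j shows that c = 0, so that Y centralises all
    transvections. *)
Lemma commutes_mod_scalars (Y : 'M[k]_n) :
    (forall i j, i != j -> exists c : k,
       Y *m transv i j 1 = transv i j 1 *m Y + c *: transv i j 1) ->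
  exists c : k, Y = c%:M.
Proof.
move=> Yc; have YE i j : i != j ->
    (forall u, u != i -> Y u i = 0) /\ Y i i = Y j j.
  move=> ij; have [c e] := Yc i j ij; have [l /andP[li lj]] := ex_third i j n_gt2.
  have eE u v := congr1 (fun A : 'M[k]_n => A u v) e.
  have := eE l l; rewrite /= !mx_linE mul_mx_transv mul_transv_mx !mxE; simp_eq.
  move/eqP; rewrite -{1}[Y l l]addr0 (inj_eq (addrI _)) => /eqP c0.
  split=> [u ui|].
    have := eE u j; rewrite /= !mx_linE mul_mx_transv mul_transv_mx !mxE -c0; simp_eq.
    by move/eqP; rewrite -{2}[Y u j]addr0 (inj_eq (addrI _)) => /eqP.
  have := eE i j; rewrite /= !mx_linE mul_mx_transv mul_transv_mx !mxE -c0; simp_eq.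
  by move/addrI.
pose o := Ordinal (ltnW (ltnW n_gt2)); exists (Y o o); apply/matrixP=> u v.
rewrite mxE; have [->|uv] := eqVneq u v.
  have [->|vo] := eqVneq v o; first by rewrite mulr1n.
  by have [_ ->] := YE v o vo; rewrite mulr1n.
have vu : v != u by rewrite eq_sym.
by have [h _] := YE v u vu; rewrite h // mulr0n.
Qed.

(** After subtracting a commutator, D is null on the root elements and so on S.
    For g in G and h in S, the relation h g = g h^g, where h^g is again in S,
    shows that D(g) r(g)^-1 commutes with r(h) modulo multiples of r(h);
    hence it is a scalar. *)
Lemma proj_der_inner D : proj_der G r D -> exists X, {in G, forall g,
  null r (fun g => D g - (X *m r g - r g *m X)) g}.
Proof.
move=> dD; have [X XE] := null_roots n_gt2 conj_reprM conj_reprI yG conj_repr_root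
  conj_repr_torus dD.
exists X; have := proj_derB conj_reprM X dD; set D' := fun g => _ => dD'.
have [o [j oj]] : exists o j : 'I_n, o != j.
  pose o := Ordinal (ltnW (ltnW n_gt2)); have [j /andP[jo _]] := ex_third o o n_gt2.
  by exists j, o.
have nS : {in S, forall g, null r D' g}.
  apply: S_ind => //.
    have [c] := dD' 1%g 1%g (group1 G) (group1 G); rewrite mulg1 conj_repr1 mulmx1 mul1mx.
    move=> e; exists (- c); apply/matrixP=> u v; move/matrixP/(_ u v): e.
    by rewrite !mx_linE conj_repr1 => e; lc e (-1 : k).
  move=> g h Sg Sh [c cE] [d dE].
  have [l lE] := dD' g h (subsetP sSG _ Sg) (subsetP sSG _ Sh).
  exists (c + d + l); rewrite lE cE dE -scalemxAl -scalemxAr -conj_reprM ?(subsetP sSG) //.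
  by rewrite -!scalerDl.
clearbody D'; move=> g Gg; have Gg' : (g^-1)%g \in G by rewrite groupV.
pose Y := D' g *m r (g^-1)%g.
have rVK h : r h *m r g *m r (g^-1)%g = r h.
  by rewrite -mulmxA -conj_reprM // mulgV conj_repr1 mulmx1.
have [|c cE] := @commutes_mod_scalars Y.
  move=> a b ab; pose h := y a b 1; have Sh : h \in S by apply: yS.
  have Gh := subsetP sSG _ Sh.
  have rh : r h = transv a b 1 by rewrite conj_repr_root // rmorph1.
  have Shg : (h ^ g)%g \in S by rewrite memJ_norm // (subsetP (normal_norm nSG)).
  have Ghg := subsetP sSG _ Shg.
  have [c1 e1] := dD' h g Gh Gg; have [c2 e2] := dD' g (h ^ g)%g Gg Ghg.
  have [c3 e3] := nS h Sh; have [c4 e4] := nS (h ^ g)%g Shg.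
  have e : c3 *: r h + r h *m Y + c1 *: r h = Y *m r h + c4 *: r h + c2 *: r h.
    move: e2; rewrite -conjgC e1 e3 e4 -!scalemxAl -!scalemxAr.
    rewrite -(conj_reprM Gh Gg) -(conj_reprM Gg Ghg) -conjgC.
    move=> /(congr1 (mulmx^~ (r (g^-1)%g))); rewrite !mulmxDl -!scalemxAl.
    rewrite (conj_reprM Gh Gg) rVK -(mulmxA (r h)) -/Y -(mulmxA (D' g)).
    rewrite -(conj_reprM Ghg Gg').
    have -> : (h ^ g * g^-1 = g^-1 * h)%g by rewrite conjgE -!mulgA mulgV mulg1.
    by rewrite (conj_reprM Gg' Gh) (mulmxA (D' g)).
  rewrite -rh.
  exists (c3 + c1 - c4 - c2); apply/matrixP=> u v; move/matrixP/(_ u v): e.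
  by rewrite !mx_linE => e; lc e (-1 : k).
exists c; have := congr1 (mulmx^~ (r g)) cE; rewrite /Y -mulmxA -conj_reprM // mulVg.
by rewrite conj_repr1 mulmx1 mul_scalar_mx.
Qed.

(** The values of a cocycle are lifted from End(V)/k to End(V); the ambiguity is
    the one that projective derivations allow. *)
Lemma H1_End_mod_scalars : H1_eq0 (End_mod_scalars_repr rG).
Proof.
move=> f fc; pose E := End_repr rG; pose E' := End_mod_scalars_repr rG.
pose C := scalars_mx k n; pose fv g : 'rV[k]_(n * n) := val_factmod (f g).
pose A g : 'M[k]_n := vec_mx (fv g).
have AE : {in G &, forall g h, exists l : k,
    A (g * h)%g = rG (h^-1)%g *m A g *m rG h + A h + l%:M}.
  move=> g h Gg Gh; have e : (fv (g * h)%g - (fv g *m E h + fv h) <= C)%MS.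
    rewrite -in_factmod_eq0 linearB linearD /= /fv !val_factmodK.
    rewrite (in_factmodJ (scalars_mxmodule rG)) // val_factmodK.
    by rewrite fc // subrr.
  rewrite /C genmxE in e; have [l lE] := sub_rVP e; exists l.
  have efv : fv (g * h)%g = fv g *m E h + fv h + l *: mxvec 1%:M.
    by rewrite -lE addrC subrK.
  rewrite /A efv !linearD linearZ /= mxvecK scalemx1; congr (_ + _ + _).
  by rewrite -[fv g]vec_mxK mul_End_mx !mxvecK.
pose D g := P *m (rG g *m A g) *m invmx P.
have [g h Gg Gh|X XE] := @proj_der_inner D.
  have [l lE] := AE g h Gg Gh; exists l; rewrite /D /r.
  rewrite lE repr_mxM // !(mulmxDr, mulmxDl) !mulmxA !(mulmxKV Pu).
  by rewrite -(mulmxA _ (rG h) (rG h^-1)%g) -repr_mxM ?groupV // mulgV repr_mx1 mulmx1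
    mul_mx_scalar -!scalemxAl.
pose Y := invmx P *m X *m P.
have fE g : g \in G -> exists c : k, A g = rG (g^-1)%g *m Y *m rG g - Y + c%:M.
  move=> Gg; have [c cE] := XE g Gg; exists c.
  have {}cE : D g = X *m r g - r g *m X + c *: r g by rewrite -cE addrC subrK.
  have e : rG g *m A g = Y *m rG g - rG g *m Y + c *: rG g.
    have := congr1 (fun M => invmx P *m M *m P) cE; rewrite /D /r /Y.
    rewrite !(mulmxDr, mulmxDl, mulmxN, mulNmx) !mulmxA !(mulmxKV Pu).
    by rewrite -!(scalemxAl, scalemxAr) !mulmxA !(mulmxKV Pu) mulVmx // !mul1mx.
  have := congr1 (mulmx (rG (g^-1)%g)) e; rewrite mulmxA -repr_mxM ?groupV // mulVg.
  rewrite repr_mx1 mul1mx => ->; rewrite mulmxDr mulmxBr !mulmxA -repr_mxM ?groupV //.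
  rewrite mulVg repr_mx1 mul1mx -scalemxAr -repr_mxM ?groupV // mulVg repr_mx1.
  by rewrite scalemx1.
exists (in_factmod C (mxvec Y)) => g Gg; have [c cE] := fE g Gg.
rewrite -[LHS]val_factmodK -/(fv g) -[fv g]vec_mxK -/(A g) cE.
rewrite !linearD linearN /= -mul_End_mx -(in_factmodJ (scalars_mxmodule rG)) //.
have -> : in_factmod (scalars_mx k n) (mxvec c%:M) = 0.
  apply/eqP; rewrite in_factmod_eq0 genmxE -(scalemx1 _ c) linearZ /=.
  by rewrite scalemx_sub.
by rewrite addr0; congr (_ + _); exact: linearN.
Qed.

(** A cocycle f is a homomorphism to k. It kills S and the scalars of G, and for
    every g in G the power g^(q-1) is a product of such elements, whereas
    q - 1 = -1 in k. *)
Lemma H1_trivial (p : nat) : p \in [pchar k] -> H1_eq0 (triv_repr k G).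
Proof.
move=> pk f fc; exists 0 => g Gg; rewrite mul0mx subr0; move: g Gg.
have fM : {in G &, forall g h, f (g * h)%g = f g + f h}.
  by move=> g h Gg Gh; rewrite fc //= mulmx1.
have f1 : f 1%g = 0 by apply: (addrI (f 1%g)); rewrite -fM // mulg1 addr0.
have fX g m : g \in G -> f (g ^+ m)%g = m%:R *: f g.
  move=> Gg; elim: m => [|m IH]; first by rewrite f1 scale0r.
  by rewrite expgS fM ?groupX // IH mulrS scalerDl scale1r.
have fS : {in S, forall g, f g = 0}.
  apply: S_ind => // [g h Sg Sh g0 h0|i j a ij].
    by rewrite fM ?(subsetP sSG) // g0 h0 addr0.
  have [l /andP[li lj]] := ex_third i j n_gt2; have il : i != l by rewrite eq_sym.
  have e : (y i l a * y l j 1%R = y l j 1%R * y i l a * y i j a)%g.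
    apply: conj_reprI; rewrite ?groupM ?yG //.
    rewrite !conj_reprM ?groupM ?yG // !conj_repr_root //.
    by rewrite transv_commutator // rmorph1 mulr1.
  have := congr1 f e; rewrite !fM ?groupM ?yG // => /eqP.
  by rewrite addrC -{1}[f _ + f _]addr0 (inj_eq (addrI _)) => /eqP.
have rS h : h \in S -> exists B : 'M[F]_n, r h = map_mx s B.
  move: h; apply: S_ind => [|g h Sg Sh [B gE] [C hE]|i j a ij].
  - by exists 1%:M; rewrite conj_repr1 map_mx1.
  - by exists (B *m C); rewrite conj_reprM ?(subsetP sSG) // gE hE map_mxM.
  exists (transv i j a).
  by rewrite conj_repr_root // map_mxD map_mx1 map_mxZ map_delta_mx.
(* an element of order divisible by p has a power of order p, which cannot be
   scalar as k has no nontrivial p-th root of unity *)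
have scal z m : z \in G -> r z = m%:M -> f z = 0.
  move=> Gz zE.
  have zX j : r (z ^+ j)%g = (m ^+ j)%:M.
    elim: j => [|j IH]; first by rewrite conj_repr1.
    by rewrite expgS conj_reprM ?groupX // IH zE -scalar_mxM exprS.
  have pz : #[z]%:R != 0 :> k.
    rewrite -(dvdn_pcharf pk); apply/negP=> /dvdnP[d dE].
    have d0 : (0 < d)%N by have := order_gt0 z; rewrite dE muln_gt0 => /andP[].
    pose o := Ordinal (ltnW (ltnW n_gt2)).
    have md : m ^+ d = 1.
      have : (m ^+ #[z])%:M = 1%:M :> 'M[k]_n by rewrite -zX expg_order conj_repr1.
      move/(congr1 (fun A : 'M_n => A o o)); rewrite !mxE eqxx !mulr1n dE exprM => mp.
      apply/eqP; rewrite -subr_eq0.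
      have := pFrobenius_autB_comm pk (mulrC (m ^+ d) 1).
      rewrite !pFrobenius_autE mp expr1n subrr.
      by move/eqP; rewrite expf_eq0 => /andP[].
    have /eqP : (z ^+ d)%g = 1%g.
      by apply: conj_reprI; rewrite ?groupX // zX md conj_repr1.
    rewrite -order_dvdn dE => /(dvdn_leq d0); rewrite leqNgt ltn_Pmulr //.
    exact: prime_gt1 (pcharf_prime pk).
  have := fX z #[z] Gz; rewrite expg_order f1 => /esym/eqP.
  by rewrite scaler_eq0 (negbTE pz) => /eqP.
move=> g Gg; have Gg' : (g^-1)%g \in G by rewrite groupV.
have rgV : r g *m r (g^-1)%g = 1%:M by rewrite -conj_reprM // mulgV conj_repr1.
have rgS (h : gT) : h \in S -> exists B : 'M[F]_n, r g *m r h *m r (g^-1)%g = map_mx s B.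
  move=> Sh; have Shg : (h ^ g^-1)%g \in S.
    by rewrite memJ_norm // (subsetP (normal_norm nSG)).
  have [B BE] := rS _ Shg; exists B; rewrite -BE conjgE invgK mulgA.
  have Gh := subsetP sSG _ Sh.
  by rewrite (conj_reprM (groupM Gg Gh) Gg') (conj_reprM Gg Gh).
(* conjugation by g preserves the matrices over F: they are spanned by the
   r(h) - 1 for h a root element and the products E_jl E_lj *)
have gd i j : exists B : 'M[F]_n, r g *m delta_mx i j *m r (g^-1)%g = map_mx s B.
  have off u v : u != v -> exists B : 'M[F]_n, r g *m delta_mx u v *m r (g^-1)%g = map_mx s B.
    move=> uv; have [B BE] := rgS _ (yS 1 uv); exists (B - 1%:M).
    rewrite map_mxB map_mx1 -BE conj_repr_root // rmorph1 /transv scale1r.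
    by rewrite mulmxDr mulmx1 mulmxDl rgV addrC addKr.
  have [->|ij] := eqVneq i j; last exact: off.
  have [l /andP[li _]] := ex_third j j n_gt2; have il : j != l by rewrite eq_sym.
  have [B BE] := off _ _ il; have [C CE] := off _ _ li; exists (B *m C).
  have rK (M : 'M_n) : M *m r (g^-1)%g *m r g = M.
    by rewrite -mulmxA -conj_reprM // mulVg conj_repr1 mulmx1.
  rewrite map_mxM -BE -CE -(mulmxA (r g) (delta_mx l j)) (mulmxA _ (r g)) rK.
  by rewrite [RHS]mulmxA -(mulmxA (r g) (delta_mx j l)) mul_delta_mx.
pose o := Ordinal (ltnW (ltnW n_gt2)).
have [j [b jb]] : exists j b, r (g^-1)%g j b != 0.
  case: (pickP (fun jb : 'I_n * 'I_n => r (g^-1)%g jb.1 jb.2 != 0)) => [[j b]|no].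
    by exists j, b.
  have r0 : r (g^-1)%g = 0.
    by apply/matrixP=> u v; move: (no (u, v)) => /negbFE/eqP /= ->; rewrite mxE.
  have := congr1 (fun A : 'M_n => A o o) rgV; rewrite /= r0 mulmx0 !mxE eqxx => /esym/eqP.
  by rewrite oner_eq0.
(* the entry (a, b) of r(g) E_ij r(g)^-1 is r(g)_ai times r(g^-1)_jb, so after
   division by a nonzero r(g^-1)_jb all entries of r(g) lie in F *)
pose c := (r (g^-1)%g j b)^-1; have c0 : c != 0 by rewrite invr_eq0.
have [B BE] := fin_all_exists (fun i => gd i j).
pose B0 := \matrix_(a, i) B i a b.
have gE : r g = c *: map_mx s B0.
  apply/matrixP=> a i; rewrite scalemxE [map_mx s B0 a i]mxE [B0 a i]mxE.
  have -> : s (B i a b) = (r g *m delta_mx i j *m r (g^-1)%g) a b by rewrite BE [RHS]mxE.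
  rewrite [(r g *m _ *m _) a b]mxE (bigD1 j) //= big1 => [|l lj]; last first.
    by rewrite mul_mx_delta (negbTE lj) mulr0 mul0r.
  by rewrite mul_mx_delta eqxx mulr1 addr0 mulrC mulfK.
have detB : \det B0 != 0.
  apply/eqP=> dB; have : \det (r g *m r (g^-1)%g) = 0.
    by rewrite det_mulmx gE detZ det_map_mx dB rmorph0 mulr0 mul0r.
  by rewrite rgV det1 => /eqP; rewrite oner_eq0.
have gX m : exists2 C : 'M[F]_n, \det C = \det B0 ^+ m & r (g ^+ m)%g = c ^+ m *: map_mx s C.
  elim: m => [|m [C dC CE]].
    by exists 1%:M; rewrite ?det1 // conj_repr1 map_mx1 scale1r.
  exists (B0 *m C); first by rewrite det_mulmx dC exprS.
  rewrite expgS conj_reprM ?groupX // CE gE map_mxM -scalemxAl -scalemxAr scalerA.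
  by rewrite exprS.
have q0 : (0 < #|F|)%N by apply/card_gt0P; exists 0.
have [C dC CE] := gX #|F|.-1.
have [h Sh hE] : exists2 h, h \in S & r h = map_mx s C.
  apply: conj_repr_SL; rewrite dC; apply: (mulIf detB).
  by rewrite -exprSr prednK // expf_card mul1r.
have Gh := subsetP sSG _ Sh; have Gh' : (h^-1)%g \in G by rewrite groupV.
have GgX : (g ^+ #|F|.-1)%g \in G by rewrite groupX.
have z0 : f (g ^+ #|F|.-1 * h^-1)%g = 0.
  apply: (scal _ (c ^+ #|F|.-1)); first by rewrite groupM.
  rewrite conj_reprM // CE -hE -scalemxAl -conj_reprM // mulgV conj_repr1.
  by rewrite scalemx1.
have := fX g #|F|.-1 Gg; rewrite -[(g ^+ _)%g](mulgKV h) fM ?groupM // z0 fS // addr0.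
have -> : #|F|.-1%:R = -1 :> k.
  apply: (addIr 1); rewrite addNr -[X in _ + X]/(1%:R) -natrD addn1 prednK //.
  by rewrite -(rmorph_nat s) natr_card_finField rmorph0.
by rewrite scaleN1r => /esym/eqP; rewrite oppr_eq0 => /eqP.
Qed.

(** * The span of the elements of order prime to p *)

Section Span.

Variable p : nat.
Hypothesis pk : p \in [pchar k].

Lemma semisimple_p'elt g : g \in G -> p^'.-elt g -> semisimple_mx (rG g).
Proof.
move=> Gg p'g U Ug; have sgG : <[g]> \subset G by rewrite cycle_subG.
pose rg := subg_repr rG sgG.
have Umod : mxmodule rg U.
  apply/mxmoduleP=> _ /cycleP[m ->]; rewrite /=.
  elim: m => [|m IH]; first by rewrite repr_mx1 mulmx1.
  by rewrite expgSr repr_mxM ?groupX // mulmxA (submx_trans (submxMr _ IH)).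
have pg : [pchar k]^'.-group <[g]>.
  rewrite /pgroup (eq_pnat _ (eq_negn (pcharf_eq pk))) -[<[g]>]/(gval <[g]>%G).
  exact: p'g.
have [W Wmod UW dUW] := mx_Maschke_pchar rg pg Umod (submx1 U).
exists W; split=> //; last exact/mxdirect_addsP.
by have /mxmoduleP/(_ g (cycle_id g)) := Wmod.
Qed.

Definition p'span (A : 'M[k]_n) : Prop := exists c : gT -> k,
  {in G, forall x, c x != 0 -> p^'.-elt x} /\
  A = \sum_(x in G) c x *: r x.

Lemma p'span_elt g : g \in G -> p^'.-elt g -> p'span (r g).
Proof.
move=> Gg p'g; exists (fun x => (x == g)%:R); split=> [x _|].
  by have [->|_] := eqVneq x g; rewrite // eqxx.
rewrite (bigD1 g) //= eqxx scale1r big1 ?addr0 // => x /andP[_ /negbTE->].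
by rewrite scale0r.
Qed.

Lemma p'spanD A B : p'span A -> p'span B -> p'span (A + B).
Proof.
move=> [c [cp ->]] [d [dp ->]]; exists (fun x => c x + d x); split=> [x Gx|].
  have [c0|/(cp x Gx)//] := eqVneq (c x) 0.
  by rewrite c0 add0r => /(dp x Gx).
by rewrite -big_split; apply: eq_bigr => x _; rewrite scalerDl.
Qed.

Lemma p'spanZ a A : p'span A -> p'span (a *: A).
Proof.
move=> [c [cp ->]]; exists (fun x => a * c x); split=> [x Gx|].
  by rewrite mulf_eq0 negb_or => /andP[_ /(cp x Gx)].
by rewrite scaler_sumr; apply: eq_bigr => x _; rewrite scalerA.
Qed.

Lemma p'spanN A : p'span A -> p'span (- A).
Proof. by move=> sA; rewrite -scaleN1r; apply: p'spanZ. Qed.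

Lemma p'spanB A B : p'span A -> p'span B -> p'span (A - B).
Proof. by move=> sA sB; apply: p'spanD => //; apply: p'spanN. Qed.

Lemma p'span_conj A h : h \in G -> p'span A -> p'span (r (h^-1)%g *m A *m r h).
Proof.
move=> Gh [c [cp ->]]; exists (fun x => c (x ^ h^-1)%g); split=> [x Gx cx|].
  by rewrite -(p_eltJ _ x h^-1) cp // groupJ // groupV.
rewrite [RHS](reindex_inj (conjg_inj h)) /= mulmx_sumr mulmx_suml.
apply: eq_big => [x|x Gx]; first by rewrite groupJr.
rewrite conjgK -scalemxAr -scalemxAl -!conj_reprM ?groupM ?groupV //.
by rewrite conjgE mulgA.
Qed.

(** The conjugate of A by x_ij(1), minus A. *)
Lemma p'span_bracket A i j : i != j -> p'span A ->
  p'span (A *m delta_mx i j - delta_mx i j *m A - A j i *: delta_mx i j).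
Proof.
move=> ij sA; set g := y i j 1; have Gg : g \in G := yG 1 ij.
have Gg' : (g^-1)%g \in G by rewrite groupV.
have gE : r g = transv i j 1 by rewrite conj_repr_root // rmorph1.
have gVE : r (g^-1)%g = transv i j (-1).
  have rr : r (g^-1)%g *m r g = 1%:M by rewrite -conj_reprM // mulVg conj_repr1.
  by rewrite -[LHS]mulmx1 -(transvVK 1 ij) mulmxA -gE rr mul1mx.
have := p'spanB (p'span_conj Gg sA) sA; rewrite gE gVE.
congr p'span; apply/matrixP=> u v.
rewrite !mx_linE mul_mx_transv !mul_transv_mx mul_mx_delta mul_delta_mxE mxE.
by rewrite -mulnb natrM; ring.
Qed.

Lemma p'span_all_roots i0 j0 : i0 != j0 -> p'span (delta_mx i0 j0) ->
  forall i j, i != j -> p'span (delta_mx i j).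
Proof.
have row i j l : i != j -> j != l -> i != l ->
    p'span (delta_mx i j) -> p'span (delta_mx i l).
  move=> ij jl il /(p'span_bracket jl).
  rewrite mul_delta_mx mul_delta_mx_0 1?eq_sym // mxE; simp_eq.
  by rewrite scale0r ?subr0.
have col i j l : i != j -> l != i -> l != j ->
    p'span (delta_mx i j) -> p'span (delta_mx l j).
  move=> ij li lj /(p'span_bracket li).
  rewrite mul_delta_mx mul_delta_mx_0 1?eq_sym // mxE; simp_eq.
  by rewrite scale0r ?subr0 ?sub0r => /p'spanN; rewrite opprK.
move=> ij0 s0; have sr j : i0 != j -> p'span (delta_mx i0 j).
  by move=> i0j; have [<-//|jj] := eqVneq j0 j; apply: (row i0 j0 j).
have sc i j : i != j -> i0 != j -> p'span (delta_mx i j).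
  move=> ij i0j; have [<-|ii] := eqVneq i0 i; first exact: sr.
  by apply: (col i0 j i) => //; [rewrite eq_sym | apply: sr].
move=> i j ij; have [ji|i0j] := eqVneq i0 j; last exact: sc.
have [l /andP[li lj]] := ex_third i j n_gt2.
have il : i != l by rewrite eq_sym.
by apply: (row i l j) => //; apply: sc => //; rewrite ji eq_sym.
Qed.

(** Brackets of the E_ij give all E_ii - E_jj, so with one more diagonal matrix
    unit the span is everything. *)
Lemma p'span_full i0 j0 l0 : i0 != j0 -> p'span (delta_mx i0 j0) ->
  p'span (delta_mx l0 l0) -> forall A, p'span A.
Proof.
move=> ij0 s0 sl; have sE := p'span_all_roots ij0 s0.
have sd i : p'span (delta_mx i i).
  have [->//|il] := eqVneq i l0; have li : l0 != i by rewrite eq_sym.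
  have := p'span_bracket li (sE _ _ il).
  rewrite !mul_delta_mx mxE !eqxx scale1r => s1.
  have := p'spanD (p'spanD s1 (sE _ _ li)) sl.
  by rewrite subrK subrK.
move=> A; rewrite (matrix_sum_delta A).
have s00 : p'span 0 by rewrite -(scale0r (delta_mx i0 j0)); apply: p'spanZ.
apply: (big_ind p'span) => //; first exact: p'spanD.
move=> i _; apply: (big_ind p'span) => //; first exact: p'spanD.
move=> j _; apply: p'spanZ; have [->|ij] := eqVneq i j; first exact: sd.
exact: sE.
Qed.

(** The involution h = diag(-1, -1, 1, ...), with -1 at o and u. Its bracket with
    E_uw is - 2 E_uw, and (1 - h) + 2 (E_oo - E_uu) = 4 E_oo. *)
Lemma p'span_odd : (2%:R : k) != 0 -> forall A, p'span A.
Proof.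
move=> two; pose o := Ordinal (ltnW (ltnW n_gt2)).
have [u /andP[uo _]] := ex_third o o n_gt2; have ou : o != u by rewrite eq_sym.
have [w /andP[wo wu]] := ex_third o u n_gt2; have uw : u != w by rewrite eq_sym.
have [h Gh hE] := conj_repr_torus ou.
have hh : (h ^+ 2 = 1)%g.
  apply: conj_reprI; rewrite ?groupX // conj_repr1 expgS expg1 conj_reprM // hE.
  rewrite mulmx_diag; apply/matrixP=> a b; rewrite !mxE.
  by case: (_ || _); rewrite /= ?mulr1 ?mulrNN ?mulr1.
have p'h : p^'.-elt h.
  apply: (@pnat_dvd _ 2); first by rewrite order_dvdn hh.
  by rewrite pnatE // inE /=; apply: contra two => /eqP p2; rewrite p2 (pcharf0 pk).
have sh := p'span_elt Gh p'h.
have s1 : p'span 1%:M.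
  by rewrite -conj_repr1; apply: p'span_elt => //; rewrite /p_elt order1.
have suw : p'span (delta_mx u w).
  have := p'spanZ (- 2%:R^-1) (p'span_bracket uw sh); congr p'span.
  apply/matrixP=> a b; rewrite hE !mx_linE mul_diag_mx mul_mx_diag !mxE.
  have [->|au] := eqVneq a u; have [->|bw] := eqVneq b w; simp_eq => //.
  by rewrite /= ?expr1 ?expr0; field.
have sE := p'span_all_roots uw suw.
have soo : p'span (delta_mx o o).
  have := p'spanD (p'span_bracket uo (sE _ _ ou)) (sE _ _ uo).
  rewrite !mul_delta_mx mxE !eqxx scale1r subrK => sou.
  have := p'spanZ (4%:R^-1) (p'spanD (p'spanB s1 sh) (p'spanZ 2%:R sou)); congr p'span.
  have four : (4%:R : k) != 0 by rewrite (natrM k 2 2) mulf_neq0.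
  apply/matrixP=> a b; rewrite hE !mx_linE !mxE.
  have [->|ab] := eqVneq a b; last first.
    by have [ao|ao] := eqVneq a o; have [au|au] := eqVneq a u; subst; simp_eq;
      rewrite ?mulr0n ?subrr ?mulr0 ?addr0 ?mulr0 //.
  have [->|bo] := eqVneq b o; first by simp_eq; rewrite /= ?expr1 ?expr0; field.
  have [_|_] := eqVneq b u; simp_eq; first by rewrite /= ?expr1 ?expr0; field.
  by rewrite /= ?expr1 ?expr0; ring.
exact: p'span_full uw suw soo.
Qed.

(** The product h of x_ou(-1) and x_uo(1), acting on the coordinates o
    and u by the matrix with rows (0, -1) and (1, 1), satisfies h^2 = h - 1 there
    and so has order 3 in characteristic 2. Its diagonal differs from that of the
    identity only at o, which gives E_oo. *)
Lemma p'span_even : (2%:R : k) = 0 -> forall A, p'span A.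
Proof.
move=> two; pose o := Ordinal (ltnW (ltnW n_gt2)).
have [u /andP[uo _]] := ex_third o o n_gt2; have ou : o != u by rewrite eq_sym.
have [w /andP[wo wu]] := ex_third o u n_gt2; have uw : u != w by rewrite eq_sym.
have ow : o != w by rewrite eq_sym.
pose h := (y o u (-1)%R * y u o 1%R)%g; have Gh : h \in G by rewrite groupM ?yG.
have hE : r h = transv o u (-1) *m transv u o 1.
  by rewrite conj_reprM ?yG // !conj_repr_root // rmorphN1 rmorph1.
clearbody h; have hhh : (h ^+ 3 = 1)%g.
  apply: conj_reprI; rewrite ?groupX // conj_repr1 !expgS expg0 mulg1.
  rewrite !conj_reprM ?groupM // hE !mulmxA.
  apply/matrixP=> a b; rewrite !mul_mx_transv !transvE mxE; simp_eq.
  apply: (lincomb1 (c := - ((a == o)%:R * (b == o)%:R + (a == u)%:R * (b == u)%:R)) two).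
  by rewrite -?mulnb ?natrM; ring.
have p'h : p^'.-elt h.
  apply: (@pnat_dvd _ 3); first by rewrite order_dvdn hhh.
  rewrite pnatE // inE /=; apply/eqP => p3; have := pcharf0 pk; rewrite -p3.
  by rewrite -[3%N]/(2 + 1)%N natrD two add0r => /eqP; rewrite oner_eq0.
have sh := p'span_elt Gh p'h.
have s1 : p'span 1%:M.
  by rewrite -conj_repr1; apply: p'span_elt => //; rewrite /p_elt order1.
have suw : p'span (delta_mx u w).
  have e : r h *m delta_mx o w - delta_mx o w *m r h - r h w o *: delta_mx o w
      = delta_mx u w - delta_mx o w.
    apply/matrixP=> a b; rewrite !mx_linE mul_mx_delta mul_delta_mxE hE.
    rewrite !mul_mx_transv !transvE !mxE (eq_sym w b); simp_eq.
    by rewrite -?mulnb ?natrM; ring.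
  have := p'span_bracket uo (p'span_bracket ow sh); rewrite e; congr p'span.
  rewrite mulmxBl mulmxBr mul_delta_mx !mul_delta_mx_0 // !mxE; simp_eq.
  by rewrite scale0r ?subr0 ?sub0r ?opprK.
have sE := p'span_all_roots uw suw.
have soo : p'span (delta_mx o o).
  have := p'spanB (p'spanD (p'spanB s1 sh) (sE _ _ uo)) (sE _ _ ou); congr p'span.
  apply/matrixP=> a b; rewrite hE !mx_linE mul_mx_transv !transvE !mxE.
  rewrite -?mulnb ?natrM; simp_eq; ring.
exact: p'span_full uw suw soo.
Qed.

Lemma p'span_all A : p'span A.
Proof.
by have [two|two] := eqVneq (2%:R : k) 0; [apply: p'span_even | apply: p'span_odd].
Qed.

Lemma semisimple_span : spanned_by_semisimple rG.
Proof.
move=> A; have [c [cp cE]] := p'span_all (P *m A *m invmx P).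
exists c => [x Gx /(cp x Gx)|]; first exact: semisimple_p'elt.
have := congr1 (fun M => invmx P *m M *m P) cE; rewrite /= !mulmxA mulVmx // mul1mx mulmxKV //.
move=> ->; rewrite mulmx_sumr mulmx_suml; apply: eq_bigr => x Gx.
by rewrite -scalemxAr -scalemxAl /r !mulmxA mulVmx // mul1mx mulmxKV.
Qed.

(** The enveloping algebra contains the span of the semisimple elements. *)
Lemma absolutely_irreducible : mx_absolutely_irreducible rG.
Proof.
rewrite /mx_absolutely_irreducible (leq_trans _ n_gt2) //= -sub1mx.
apply/row_subP=> i; rewrite -[row i _]vec_mxK; set A := vec_mx _.
have [c _ ->] := semisimple_span A; rewrite linear_sum /=; apply: summx_sub => x Gx.
by rewrite linearZ scalemx_sub //; apply: envelop_mx_id.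
Qed.

Lemma natural_module_adequate : adequate rG.
Proof.
split; [exact: absolutely_irreducible | exact: H1_trivial pk
       | exact: H1_End_mod_scalars | exact: semisimple_span].
Qed.

End Span.

End NaturalModule.

(** * Groups with a normal subgroup isomorphic to SL_n(F) *)

(** The transvections are pulled back through the isomorphism. *)
Lemma SL_root_elements (F : finFieldType) n' (gT : finGroupType) (S : {group gT}) :
    S \isog SL n'.+3 F ->
  exists x : 'I_n'.+3 -> 'I_n'.+3 -> F -> gT,
  [/\ steinberg x, (forall i j a, i != j -> x i j a \in S),
      (forall i j a, i != j -> a != 0 -> x i j a != 1%g)
    & forall K : gT -> Prop, K 1%g ->
        {in S &, forall g h, K g -> K h -> K (g * h)%g} ->
        (forall i j a, i != j -> K (x i j a)) -> {in S, forall g, K g}].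
Proof.
set n := n'.+3; case/isogP=> f injf fS; pose m g : 'M[F]_n := GLval (f g).
have mM : {in S &, forall g h, m (g * h)%g = m g *m m h}.
  by move=> g h Sg Sh; rewrite /m morphM.
have m1 : m 1%g = 1%:M by rewrite /m morph1.
have mI : {in S &, injective m}.
  by move=> g h Sg Sh e; apply: (injmP injf) => //; apply: val_inj.
have ex i j a : i != j -> exists g, (g \in S) && (m g == transv i j a).
  move=> ij; have dt : \det (transv i j a) = 1 := det_transv a ij.
  have ut : transv i j a \is a GRing.unit by rewrite unitmxE dt unitr1.
  pose u : {'GL_n[F]} := Sub (transv i j a) ut.
  have : u \in f @* S by rewrite fS inE /= dt.
  case/morphimP=> g _ Sg ug; exists g; rewrite Sg /m -ug /=; exact/eqP.
pose x i j a := odflt 1%g [pick g | (g \in S) && (m g == transv i j a)].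
have xP i j a : i != j -> x i j a \in S /\ m (x i j a) = transv i j a.
  move=> ij; rewrite /x; case: pickP => [g /andP[Sg /eqP]//|no].
  by have [g] := ex i j a ij; rewrite no.
have xS i j a : i != j -> x i j a \in S by case/(xP i j a).
have mx i j a : i != j -> m (x i j a) = transv i j a by case/(xP i j a).
exists x; split=> //.
- split=> [i j a b ij|i j l u a b ij lu jl iu|i j l a b ij jl il].
  + apply: mI; rewrite ?groupM ?xS // mM ?xS // !mx //.
    apply/matrixP=> u v; rewrite mul_mx_transv !transvE; simp_eq.
    by rewrite -mulnb natrM; ring.
  + by apply: mI; rewrite ?groupM ?xS // !mM ?xS // !mx // transv_comm.
  have e : (x i j a * x j l b = x j l b * x i j a * x i l (a * b)%R)%g.
    apply: mI; rewrite ?groupM ?xS //.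
    by rewrite !mM ?groupM ?xS // !mx // transv_commutator.
  by apply: (mulgI (x j l b * x i j a)%g); rewrite -e -commgC.
- move=> i j a ij; apply: contraNneq => x1; have := mx i j a ij; rewrite x1 m1.
  move/(congr1 (fun A : 'M_n => A i j)); rewrite transvE !mxE; simp_eq.
  by move=> <-.
move=> K K1 KM Kx g Sg.
suff [h [Sh hE Kh]] : exists h, [/\ h \in S, m h = m g & K h].
  by rewrite -(mI h g Sh Sg hE).
have : \det (m g) = 1.
  have : f g \in f @* S by rewrite mem_morphim.
  by rewrite fS inE => /eqP.
apply: (@det1_transv_closed F n (fun A => exists h, [/\ h \in S, m h = A & K h])).
split.
- by exists 1%g.
- move=> A B [h [Sh hE Kh]] [u [Su uE Ku]]; exists (h * u)%g.
  by rewrite groupM // mM // hE uE; split=> //; apply: KM.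
by move=> i j a ij; exists (x i j a); rewrite xS // mx //; split=> //; apply: Kx.
Qed.

Theorem theorem10p1 (p q e : nat) (hp : prime p) (he : (0 < e)%N)
    (hq : q = (p ^ e)%N)
    (Fq : finFieldType) (hFq : #|Fq| = q)
    (k : closedFieldType) (hk : p \in [pchar k])
    (n : nat) (hn : (2 < n)%N)
    (gT : finGroupType) (G S : {group gT})
    (rG : mx_representation k G n) (hG : mx_faithful rG)
    (hSG : S <| G) (hS : S \isog SL n Fq) :
  adequate rG.
Proof.
have pF : p \in [pchar Fq] by apply: (card_finPcharP (n := e)); rewrite ?hFq.
case: n hn rG hG hS => [|[|[|n']]] // hn rG hG hS.
have [x [stx xS x1 xind]] := SL_root_elements hS.
have sSG := subsetP (normal_sub hSG).
have xR : root_system_in rG x.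
  split=> // [i j a ij|i j a ij a0]; first by apply: sSG; apply: xS.
  apply: contra (x1 i j a ij a0) => /eqP r1; rewrite -in_set1.
  by apply: (subsetP hG); apply/rkerP; split=> //; apply: sSG; apply: xS.
have [y yx [s [P [Pu yE]]]] := root_classification pF hn hk xR.
have [yS yind] : (forall i j a, i != j -> y i j a \in S) /\
    (forall K : gT -> Prop, K 1%g ->
        {in S &, forall g h, K g -> K h -> K (g * h)%g} ->
        (forall i j a, i != j -> K (y i j a)) -> {in S, forall g, K g}).
  case: yx => ->; first by split.
  split=> [i j a ij|K K1 KM Ky]; first by apply: xS; rewrite eq_sym.
  apply: xind => // i j a ij; rewrite -[a]opprK; apply: (Ky j i (- a)).
  by rewrite eq_sym.
exact: (natural_module_adequate hn hG hSG Pu yS yE yind hk).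
Qed.
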